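(* Let $(M,g)$ be a smooth $n$-dimensional Riemannian manifold, $n\ge 3$, with Ricci tensor $\mathsf{Ri}\ne 0$. Then $\mathsf{Ri}$ cannot be at the same time Ricci recurrent and Cotton.
   Context: $g$ is positive definite, a semicolon denotes covariant differentiation with respect to the Levi-Civita connection, and $\mathsf{sc}=g^{ij}\mathsf{Ri}_{ij}$ is the scalar curvature. The Ricci tensor is Ricci recurrent if there is a nonzero one-form $\beta$ such that $\mathsf{Ri}_{ij;\ell}=\beta_\ell\,\mathsf{Ri}_{ij}$. The Schouten tensor is $S=\mathsf{Ri}-\frac{\mathsf{sc}}{2n-2}\,g$, and the Cotton tensor is $C_{ijk}=S_{ij;k}-S_{ik;j}$. The Ricci tensor is Cotton if the Cotton tensor is zero. *)

(* Defs.v *)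
From HB Require Import structures.
From mathcomp Require Import all_boot all_order all_algebra.
From mathcomp Require Import all_classical all_reals all_analysis.

Set Implicit Arguments.
Unset Strict Implicit.
Unset Printing Implicit Defensive.

Import Order.TTheory GRing.Theory Num.Theory.
Import numFieldNormedType.Exports.

Local Open Scope classical_set_scope.
Local Open Scope ring_scope.

Definition partial (R : realType) (n : nat) (W : normedModType R) (i : 'I_n)
    (f : 'rV[R]_n -> W) : 'rV[R]_n -> W :=
  fun x => 'D_(delta_mx 0 i) f x.

(* All iterated partial derivatives are differentiable at every point of U.
   Since partial derivatives are local, for open U the values of f outside U
   play no role. *)
Definition smooth_on (R : realType) (n : nat) (W : normedModType R)
    (U : set 'rV[R]_n) (f : 'rV[R]_n -> W) : Prop :=
  forall (s : seq 'I_n) (x : 'rV[R]_n), U x ->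
    differentiable (foldr (@partial R n W) f s) x.

(* A homeomorphism from an open subset of M onto an open subset of R^n; the
   total functions chart_map and chart_inv are meaningful only on chart_dom and
   chart_img respectively. *)
Record chart (R : realType) (n : nat) (M : topologicalType) := Chart {
  chart_dom : set M;
  chart_map : M -> 'rV[R]_n;
  chart_inv : 'rV[R]_n -> M;
  chart_dom_open : open chart_dom;
  chart_img_open : open (chart_map @` chart_dom);
  chart_mapK : forall p, chart_dom p -> chart_inv (chart_map p) = p;
  chart_map_continuous : {within chart_dom, continuous chart_map};
  chart_inv_continuous :
    {within chart_map @` chart_dom, continuous chart_inv}
}.

Definition chart_img (R : realType) (n : nat) (M : topologicalType)
    (c : chart R n M) : set 'rV[R]_n :=
  chart_map c @` chart_dom c.

Definition overlap (R : realType) (n : nat) (M : topologicalType)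
    (c d : chart R n M) : set 'rV[R]_n :=
  chart_map c @` (chart_dom c `&` chart_dom d).

Definition transition (R : realType) (n : nat) (M : topologicalType)
    (c d : chart R n M) : 'rV[R]_n -> 'rV[R]_n :=
  chart_map d \o chart_inv c.

Record smooth_manifold (R : realType) (n : nat) := SmoothManifold {
  carrier :> topologicalType;
  manifold_hausdorff : hausdorff_space carrier;
  manifold_second_countable : @second_countable carrier;
  atlas : set (chart R n carrier);
  atlas_cover : forall p : carrier, exists2 c, atlas c & chart_dom c p;
  atlas_smooth : forall c d, atlas c -> atlas d ->
    smooth_on (overlap c d) (transition c d)
}.

(* Smooth tensor fields are given by their components in the charts of the
   atlas.  With the row-vector convention of 'J, the entry (i, k) of
   'J (transition c d) x is the partial derivative of the k-th new coordinate
   along the i-th old one. *)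
Record one_form (R : realType) (n : nat) (M : smooth_manifold R n) := OneForm {
  one_form_comp :> chart R n M -> 'rV[R]_n -> 'rV[R]_n;
  one_form_smooth : forall c, atlas c ->
    smooth_on (chart_img c) (one_form_comp c);
  one_form_transform : forall c d, atlas c -> atlas d ->
    forall x, overlap c d x ->
      one_form_comp c x =
        one_form_comp d (transition c d x) *m ('J (transition c d) x)^T
}.

Record riemannian_metric (R : realType) (n : nat) (M : smooth_manifold R n) :=
  RiemannianMetric {
  metric_comp :> chart R n M -> 'rV[R]_n -> 'M[R]_n;
  metric_smooth : forall c, atlas c ->
    smooth_on (chart_img c) (metric_comp c);
  metric_transform : forall c d, atlas c -> atlas d ->
    forall x, overlap c d x ->
      metric_comp c x =
        'J (transition c d) x *m metric_comp d (transition c d x)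
          *m ('J (transition c d) x)^T;
  metric_sym : forall c, atlas c -> forall x, chart_img c x ->
    (metric_comp c x)^T = metric_comp c x;
  metric_posdef : forall c, atlas c -> forall x, chart_img c x ->
    forall v : 'rV[R]_n, v != 0 -> 0 < (v *m metric_comp c x *m v^T) 0 0
}.

(* Classical coordinate formulas.  G is the matrix of components g_ij of the
   metric in a fixed chart, as a function of the coordinates. *)
Section Coordinates.
Context (R : realType) (n : nat).
Implicit Types (G T : 'rV[R]_n -> 'M[R]_n) (i j k l : 'I_n) (x : 'rV[R]_n).

Definition christoffel G k i j x : R :=
  2^-1 * \sum_l invmx (G x) k l *
    (partial i (fun y => G y l j) x + partial j (fun y => G y l i) x
     - partial l (fun y => G y i j) x).

(* R^l_{kij}, with R(d_i, d_j) d_k = R^l_{kij} d_l and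
   R(X, Y) = [nabla_X, nabla_Y] - nabla_[X, Y]. *)
Definition riemann G l k i j x : R :=
  partial i (christoffel G l j k) x - partial j (christoffel G l i k) x
  + \sum_m (christoffel G l i m x * christoffel G m j k x
            - christoffel G l j m x * christoffel G m i k x).

Definition ricci G x : 'M[R]_n :=
  \matrix_(i, j) \sum_l riemann G l i l j x.

Definition scalar_curvature G x : R :=
  \sum_i \sum_j invmx (G x) i j * ricci G x i j.

(* T_{ij;l} *)
Definition covariant_derivative G T i j l x : R :=
  partial l (fun y => T y i j) x
  - \sum_m christoffel G m l i x * T x m j
  - \sum_m christoffel G m l j x * T x i m.

Definition schouten G x : 'M[R]_n :=
  ricci G x - (scalar_curvature G x / (2 * n%:R - 2)) *: G x.

Definition cotton G i j k x : R :=
  covariant_derivative G (schouten G) i j k x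
  - covariant_derivative G (schouten G) i k j x.

End Coordinates.

Definition ricci_nonzero (R : realType) (n : nat) (M : smooth_manifold R n)
    (g : riemannian_metric M) : Prop :=
  exists c, atlas c /\ exists2 x, chart_img c x & ricci (g c) x != 0.

(* The form does not vanish identically on any connected component of M.  For
   connected M this says that it is not identically zero (see
   one_form_nonzero_connected), and every nowhere vanishing form is nonzero.
   Without it, the disjoint union of a round sphere and a flat torus, with a
   form supported on the torus, would be Ricci recurrent and Cotton. *)
Definition one_form_nonzero (R : realType) (n : nat) (M : smooth_manifold R n)
    (beta : one_form M) : Prop :=
  forall p : M, exists q c,
    [/\ connected_component setT p q, atlas c, chart_dom c q
      & beta c (chart_map c q) != 0].

Lemma one_form_nonzero_connected (R : realType) (n : nat)
    (M : smooth_manifold R n) (beta : one_form M) (p0 : M) :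
  connected [set: M] ->
  one_form_nonzero beta <->
  exists q c, [/\ atlas c, chart_dom c q & beta c (chart_map c q) != 0].
Proof.
move=> connM; split=> [/(_ p0) [q [c [_ ? ? ?]]]|[q [c [? ? ?]]] p].
  by exists q, c.
exists q, c; split => //.
by exists [set: M].
Qed.

Definition ricci_recurrent (R : realType) (n : nat) (M : smooth_manifold R n)
    (g : riemannian_metric M) : Prop :=
  exists2 beta : one_form M, one_form_nonzero beta &
    forall c, atlas c -> forall x, chart_img c x -> forall i j l,
      covariant_derivative (g c) (ricci (g c)) i j l x =
        beta c x 0 l * ricci (g c) x i j.

Definition ricci_cotton (R : realType) (n : nat) (M : smooth_manifold R n)
    (g : riemannian_metric M) : Prop :=
  forall c, atlas c -> forall x, chart_img c x -> forall i j k,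
    cotton (g c) i j k x = 0.

(* Main.v *)
(* Suppose Ri_{ij;l} = beta_l Ri_ij and the Cotton tensor vanishes.  Then
   S_{ij;k} = beta_k S_ij, so beta_k S_ij = beta_j S_ik, and where beta <> 0 we
   get S_ij = a_i beta_j for some covector a.  Let F_kl be the curvature
   operators, acting on covectors.  Commuting second covariant derivatives of g
   and of Ri shows that F_kl is skew for g and that F_kl.Ri = - w_kl Ri with
   w = d beta; tracing with g gives w sc = 0, so F_kl also acts on S by - w_kl.
   Skewness then forces w = 0 and F_kl a = F_kl beta = 0 unless a = 0, hence
   the vectors dual to a and beta are in the kernel of Ri.  Since
   g(a, beta) = (n-2) sc / (2n-2), evaluating Ri = a beta + sc / (2n-2) g on them
   gives sc = 0 and a = 0.  So Ri = 0 wherever beta <> 0.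

   By uniqueness for linear ordinary differential equations the zero set of a
   recurrent tensor is open; it is also closed, and independent of the charts
   because Ri is a tensor.  As beta is nonzero somewhere on each connected
   component, Ri vanishes identically. *)
Require Import Defs.
From mathcomp Require Import all_boot all_order all_algebra.
From mathcomp Require Import all_classical all_reals all_analysis.
From mathcomp Require Import ring lra.

Set Implicit Arguments.
Unset Strict Implicit.
Unset Printing Implicit Defensive.

Import Order.TTheory GRing.Theory Num.Theory.
Import numFieldNormedType.Exports.

Local Open Scope classical_set_scope.
Local Open Scope ring_scope.

(** * Partial derivatives *)

(** The first-order expansion of [f] at [x] is also one of [g]; [diff_unique] then identifies the
    differential of [g] with the continuous map ['d f x]. *)
Lemma near_eq_differentiable (R : numFieldType) (V W : normedModType R)
    (f g : V -> W) (x : V) :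
  {near x, f =1 g} -> differentiable f x -> differentiable g x.
Proof.
move=> fg df; have [dfc dfx] := (diff_locallyP x f).1 df.
have gx : f x = g x := nbhs_singleton fg.
have E : g \o shift x = cst (g x) + 'd f x +o_ (0 : V) id.
  apply/eqaddoP => e e0.
  have /eqaddoP /(_ e e0) He := dfx.
  have fg0 : \forall y \near 0, f (y + x) = g (y + x).
    have : \forall y \near x, f y = g y by exact: fg.
    rewrite (near_shift 0 x [set y | f y = g y]).
    by apply: filterS => y /=; rewrite subr0.
  by near=> y; rewrite !fctE /= -(near fg0 y _)// -gx; apply: (near He y).
have dg := diff_unique dfc E.
by apply/diff_locallyP; rewrite dg.
Unshelve. all: by end_near. Qed.

Section Partial.
Context (R : realType) (n : nat).
Local Notation E := 'rV[R]_n.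
Implicit Types (f g h : E -> R) (x : E) (i j : 'I_n) (U : set E).

Lemma eq_on_near (T : Type) (F G : E -> T) U x :
  open U -> U x -> {in U, F =1 G} -> \forall y \near x, F y = G y.
Proof.
move=> oU Ux FG; have := open_nbhs_nbhs (conj oU Ux).
by apply: filterS => y Uy; apply: FG; rewrite inE.
Qed.

Lemma eq_on_differentiable (W : normedModType R) (F G : E -> W) U x :
  open U -> U x -> {in U, F =1 G} -> differentiable F x -> differentiable G x.
Proof. by move=> oU Ux FG; apply/near_eq_differentiable/(eq_on_near oU). Qed.

Lemma eq_on_partial (W : normedModType R) (F G : E -> W) U x i :
  open U -> U x -> {in U, F =1 G} -> partial i F x = partial i G x.
Proof. by move=> oU Ux FG; apply/near_eq_derive/(eq_on_near oU). Qed.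

Lemma partial_cst (a : R) i x : partial i (fun=> a) x = 0.
Proof. exact: derive_cst. Qed.

Lemma partialD f g i x : differentiable f x -> differentiable g x ->
  partial i (fun y => f y + g y) x = partial i f x + partial i g x.
Proof. by move=> df dg; apply: deriveD; apply: diff_derivable. Qed.

Lemma partialN f i x : differentiable f x ->
  partial i (fun y => - f y) x = - partial i f x.
Proof. by move=> df; apply: deriveN; apply: diff_derivable. Qed.

Lemma partialM f g i x : differentiable f x -> differentiable g x ->
  partial i (fun y => f y * g y) x = partial i f x * g x + f x * partial i g x.
Proof.
move=> df dg; rewrite /partial (@deriveM _ _ f g); try exact: diff_derivable.
by rewrite addrC; congr (_ + _); rewrite /GRing.scale/= mulrC.
Qed.

Lemma partialV f i x : differentiable f x -> f x != 0 ->
  partial i (fun y => (f y)^-1) x = - (partial i f x * ((f x)^-1 * (f x)^-1)).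
Proof.
move=> df f0; rewrite /partial (@deriveV _ _ f)//; last exact: diff_derivable.
by rewrite /GRing.scale/= expr2 invfM mulNr mulrC.
Qed.

Lemma differentiable_bigsum (I : Type) (r : seq I) (F : I -> E -> R) x :
  (forall k, differentiable (F k) x) ->
  differentiable (fun y => \sum_(k <- r) F k y) x.
Proof.
move=> dF; elim: r => [|k r IH].
  by under eq_fun do rewrite big_nil; exact: differentiable_cst.
by under eq_fun do rewrite big_cons; exact: differentiableD.
Qed.

Lemma partial_sum (I : Type) (r : seq I) (F : I -> E -> R) i x :
  (forall k, differentiable (F k) x) ->
  partial i (fun y => \sum_(k <- r) F k y) x = \sum_(k <- r) partial i (F k) x.
Proof.
move=> dF; elim: r => [|k r IH].
  by under eq_fun do rewrite big_nil; rewrite big_nil partial_cst.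
under eq_fun do rewrite big_cons.
by rewrite partialD ?big_cons ?IH//; exact: differentiable_bigsum.
Qed.

Lemma differentiable_entry p q (F : E -> 'M[R]_(p, q)) a b x :
  differentiable F x -> differentiable (fun y => F y a b) x.
Proof.
move=> dF; apply: (@differentiable_comp _ _ _ _ F (fun M : 'M[R]_(p, q) => M a b)) => //.
exact: differentiable_coord.
Qed.

Lemma partial_entry p q (F : E -> 'M[R]_(p, q)) a b i x :
  differentiable F x -> partial i (fun y => F y a b) x = partial i F x a b.
Proof.
by move=> dF; rewrite /partial derive_mx ?mxE//; exact: diff_derivable.
Qed.

Lemma derive_partial f x v : differentiable f x ->
  'D_v f x = \sum_i v 0 i * partial i f x.
Proof.
move=> df; rewrite deriveE// {1}(row_sum_delta v) linear_sum.
by apply: eq_bigr => i _; rewrite linearZ /partial deriveE.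
Qed.

Lemma partial_comp (phi : E -> E) h i x :
  differentiable phi x -> differentiable h (phi x) ->
  partial i (h \o phi) x =
    \sum_b 'J phi x i b * partial b h (phi x).
Proof.
move=> dphi dh; rewrite {1}/partial deriveE; last exact: differentiable_comp.
rewrite diff_comp//= -deriveE// derive_partial//.
by apply: eq_bigr => b _; rewrite mxE.
Qed.

Lemma jacobianE (phi : E -> E) x i k :
  differentiable phi x -> 'J phi x i k = partial i (fun y => phi y 0 k) x.
Proof. by move=> dphi; rewrite partial_entry// /partial deriveE// mxE. Qed.

End Partial.

(** * Symmetry of second derivatives *)

Section Schwarz.
Context (R : realType) (V : normedModType R).
Implicit Types (f : V -> R) (x u v : V) (U : set V).

Lemma is_derive_line f x u t : differentiable f (x + t *: u) ->
  is_derive t (1 : R) (fun s => f (x + s *: u)) ('D_u f (x + t *: u)).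
Proof.
move=> df; have E : (fun h : R => h^-1 *: (f (x + (h *: 1 + t) *: u) - f (x + t *: u)))
    = (fun h => h^-1 *: (f (h *: u + (x + t *: u)) - f (x + t *: u))).
  apply/funext => h; congr (_ *: (f _ - _)).
  by rewrite [h%:A]mulr1 scalerDl addrCA.
have dfu := diff_derivable (v := u) df.
by apply: DeriveDef; rewrite /derivable /derive /= E.
Qed.

(** The mean value theorem, applied to the difference [g] of [f] along two parallel segments, leaves
    a difference of two values of ['D_u f]. The first-order expansion of ['D_u f] at [x] turns it
    into [h * 'D_v ('D_u f) x] up to a small error. *)
Lemma second_difference f x u v U (e : R) : open U -> U x ->
  (forall y, U y -> differentiable f y) -> differentiable ('D_u f) x -> 0 < e ->
  \forall h \near 0^'+,
   `|f (x + h *: u + h *: v) - f (x + h *: u) - f (x + h *: v) + f x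
     - h ^+ 2 * 'D_v ('D_u f) x| <= e * h ^+ 2.
Proof.
move=> oU Ux df dDf e0.
(* The two expansion errors are at most [e'] times the norms of [c *: u + h *: v] and [c *: u] with
   [0 < c < h], hence at most [e' * h * (2 * |u| + |v|)] together; the added 1 keeps the denominator
   positive. *)
pose e' := e / (2 * `|u| + `|v| + 1).
have den0 : 0 < 2 * `|u| + `|v| + 1 by rewrite ltr_wpDl// addr_ge0// mulr_ge0.
have e'0 : 0 < e' by rewrite divr_gt0.
have nU : \forall w \near 0, U (x + w).
  have := open_nbhs_nbhs (conj oU Ux); rewrite -[nbhs x U]/(\near x, U x) nbhs0P.
  by [].
have nD : \forall w \near 0,
    `|'D_u f (x + w) - 'D_u f x - 'd ('D_u f) x w| <= e' * `|w|.
  have /eqaddoP/(_ _ e'0) := diff_locally dDf.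
  apply: filterS => w; rewrite !fctE/= opprD addrA [w + x]addrC; exact.
have [d /= d0 Hd] := nbhs_norm0P.1 (filterI nU nD).
near=> h.
have h0 : 0 < h by near: h; exact: nbhs_right_gt.
have hd : h * (`|u| + `|v| + 1) < d.
  rewrite -ltr_pdivlMr ?ltr_wpDl//; near: h.
  by apply: nbhs_right_lt; rewrite divr_gt0// ltr_wpDl.
have small a b : 0 <= a <= h -> 0 <= b <= h -> `|a *: u + b *: v| < d.
  move=> /andP[a0 ah] /andP[b0 bh]; apply: le_lt_trans hd.
  rewrite (le_trans (ler_normD _ _))// !normrZ !ger0_norm// mulrDr mulr1 mulrDr.
  by rewrite ler_wpDr// ?(ltW h0)// lerD// ler_wpM2r.
pose g t := f (x + h *: v + t *: u) - f (x + t *: u).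
pose dg t := 'D_u f (x + h *: v + t *: u) - 'D_u f (x + t *: u).
have dgP t : 0 <= t <= h -> is_derive t (1 : R) g (dg t).
  move=> th; apply: is_deriveB; apply: is_derive_line; apply: df.
    rewrite -addrA [h *: v + _]addrC; apply: (Hd _ _).1 => /=.
    by apply: small => //; rewrite lexx ltW.
  apply: (Hd _ _).1 => /=; rewrite -[t *: u]addr0 -(scale0r v); apply: small => //.
  by rewrite lexx ltW.
have [||c /[!in_itv]/= /andP[c0 ch]] := @MVT _ g dg 0 h h0.
- by move=> t /[!in_itv]/= /andP[t0 th]; apply: dgP; rewrite !ltW.
- apply: derivable_within_continuous => t /[!in_itv]/= th.
  exact: (ex_derive (is_derive := dgP _ th)).
rewrite subr0 /g /dg !scale0r !addr0 => Eg.
have c01 : 0 <= c <= h by rewrite !ltW.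
have h01 : 0 <= h <= h by rewrite lexx ltW.
have H1 := (Hd _ (small _ _ c01 h01)).2; rewrite /= in H1.
have H2 : `|c *: u| < d.
  by rewrite -[c *: u]addr0 -(scale0r v) small// lexx ltW.
have {}H2 := (Hd _ H2).2; rewrite /= in H2.
have L : 'd ('D_u f) x (c *: u + h *: v) - 'd ('D_u f) x (c *: u) = h * 'D_v ('D_u f) x.
  by rewrite deriveE// linearD addrAC subrr add0r linearZ.
have -> : f (x + h *: u + h *: v) - f (x + h *: u) - f (x + h *: v) + f x
     - h ^+ 2 * 'D_v ('D_u f) x =
   h * (('D_u f (x + (c *: u + h *: v)) - 'D_u f x - 'd ('D_u f) x (c *: u + h *: v)) -
   ('D_u f (x + c *: u) - 'D_u f x - 'd ('D_u f) x (c *: u))).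
  have -> : f (x + h *: u + h *: v) - f (x + h *: u) - f (x + h *: v) + f x =
     ('D_u f (x + (c *: u + h *: v)) - 'D_u f (x + c *: u)) * h.
    rewrite [c *: u + _]addrC [in RHS]addrA -Eg [x + h *: u + h *: v]addrAC.
    by rewrite opprB addrA; ring.
  by rewrite expr2 -mulrA -L; ring.
rewrite normrM gtr0_norm// expr2 mulrCA ler_pM2l//.
rewrite (le_trans (ler_normB _ _))// (le_trans (lerD H1 H2))//.
have -> : e * h = e' * (h * (2 * `|u| + `|v| + 1)).
  by rewrite [e * h]mulrC mulrCA /e' divfK// lt0r_neq0.
rewrite -mulrDr ler_pM2l//.
apply: (@le_trans _ _ (h * `|u| + h * `|v| + h * `|u|)).
  by rewrite (le_trans (lerD (ler_normD _ _) (lexx _)))// !normrZ !gtr0_norm//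
    !lerD// ler_wpM2r// ltW.
have -> : h * (2 * `|u| + `|v| + 1) = h * `|u| + h * `|v| + h * `|u| + h by ring.
by rewrite lerDl ltW.
Unshelve. all: by end_near. Qed.

(** The second difference is symmetric in [u] and [v], and for small [h] both iterated derivatives,
    multiplied by [h ^+ 2], lie within [e / 2 * h ^+ 2] of it. *)
Lemma derive_sym f x u v U : open U -> U x ->
  (forall y, U y -> differentiable f y) ->
  differentiable ('D_u f) x -> differentiable ('D_v f) x ->
  'D_v ('D_u f) x = 'D_u ('D_v f) x.
Proof.
move=> oU Ux df du dv; apply/eqP; rewrite -subr_eq0 -normr_le0.
apply/ler_addgt0Pr => e e0; rewrite add0r.
have e20 : 0 < e / 2 by rewrite divr_gt0.
have [h [[H1 H2] h0]] := @filter_ex _ (0^'+ : set_system R) _ _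
  (filterI (filterI (second_difference v oU Ux df du e20)
   (second_difference u oU Ux df dv e20)) (nbhs_right_gt 0)).
have h20 : 0 < h ^+ 2 by rewrite exprn_gt0.
rewrite -(ler_pM2l h20) -[X in X * `|_|](gtr0_norm h20) -normrM.
rewrite [x + h *: v + h *: u]addrAC in H2.
move: H1 H2; move: ('D_v ('D_u f) x) ('D_u ('D_v f) x) => p q.
move: (f (x + h *: u + h *: v)) (f (x + h *: u)) (f (x + h *: v)) (f x) => A B C D H1 H2.
have := le_trans (ler_normB _ _) (lerD H2 H1).
have -> : e / 2 * h ^+ 2 + e / 2 * h ^+ 2 = h ^+ 2 * e by field.
by have -> : A - C - B + D - h ^+ 2 * q - (A - B - C + D - h ^+ 2 * p)
  = h ^+ 2 * (p - q) by ring.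
Qed.

End Schwarz.

(** * Smooth functions and matrices *)

Section Smooth.
Context (R : realType) (n : nat).
Local Notation E := 'rV[R]_n.
Implicit Types (f g h : E -> R) (x : E) (i j : 'I_n) (U : set E).

(* Unlike the iterated partials of smooth_on, this recursion on the order makes
   closure under products and inverses a plain induction. *)
Fixpoint Ck U (k : nat) f : Prop :=
  if k is k'.+1 then
    (forall x, U x -> differentiable f x) /\ forall i, Ck U k' (partial i f)
  else True.

Definition smoothf U f := forall k, Ck U k f.

Lemma smoothf_differentiable U f x : smoothf U f -> U x -> differentiable f x.
Proof. by move=> /(_ 1%N)[df _]; exact: df. Qed.

Lemma smoothf_partial U f i : smoothf U f -> smoothf U (partial i f).
Proof. by move=> sf k; have [_] := sf k.+1; apply. Qed.

Lemma CkW U k f : Ck U k.+1 f -> Ck U k f.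
Proof.
elim: k f => [//|k IH] f [df dpf]; split=> // i; exact: IH (dpf i).
Qed.

Lemma eq_on_Ck U k f g : open U -> {in U, f =1 g} -> Ck U k f -> Ck U k g.
Proof.
move=> oU; elim: k f g => [//|k IH] f g fg [df pf]; split=> [x Ux|i].
  exact: eq_on_differentiable oU Ux fg (df x Ux).
apply: IH (pf i) => x; rewrite inE => Ux; exact: eq_on_partial fg.
Qed.

Lemma eq_on_smoothf U f g : open U -> {in U, f =1 g} -> smoothf U f -> smoothf U g.
Proof. by move=> oU fg sf k; apply: eq_on_Ck fg (sf k). Qed.

Lemma smoothf_cst U a : smoothf U (fun=> a).
Proof.
move=> k; elim: k a => [//|k IH] a; split=> [x _|i]; first exact: differentiable_cst.
by rewrite (_ : partial i _ = fun=> 0); [exact: IH|apply/funext => x; exact: partial_cst].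
Qed.

Lemma CkD U k f g : open U -> Ck U k f -> Ck U k g -> Ck U k (fun x => f x + g x).
Proof.
move=> oU; elim: k f g => [//|k IH] f g [df pf] [dg pg]; split=> [x Ux|i].
  by apply: differentiableD; [exact: df|exact: dg].
apply: eq_on_Ck (IH _ _ (pf i) (pg i)) => // x; rewrite inE => Ux.
by rewrite partialD//; [exact: df|exact: dg].
Qed.

Lemma CkN U k f : open U -> Ck U k f -> Ck U k (fun x => - f x).
Proof.
move=> oU; elim: k f => [//|k IH] f [df pf]; split=> [x Ux|i].
  by apply: differentiableN; exact: df.
apply: eq_on_Ck (IH _ (pf i)) => // x; rewrite inE => Ux.
by rewrite partialN//; exact: df.
Qed.

Lemma CkM U k f g : open U -> Ck U k f -> Ck U k g -> Ck U k (fun x => f x * g x).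
Proof.
move=> oU; elim: k f g => [//|k IH] f g Cf Cg.
have [df pf] := Cf; have [dg pg] := Cg; split=> [x Ux|i].
  by apply: differentiableM; [exact: df|exact: dg].
have := CkD oU (IH _ _ (pf i) (CkW Cg)) (IH _ _ (CkW Cf) (pg i)).
apply: eq_on_Ck => // x; rewrite inE => Ux.
by rewrite partialM//; [exact: df|exact: dg].
Qed.

(** Induction on the order: a partial derivative of the inverse is, up to sign, the product of
    [partial i f] with two copies of the inverse, already smooth to the lower order. *)
Lemma CkV U k f : open U -> (forall x, U x -> f x != 0) -> Ck U k f ->
  Ck U k (fun x => (f x)^-1).
Proof.
move=> oU f0; elim: k => [//|k IH] Cf.
have [df pf] := Cf; have CV := IH (CkW Cf); split=> [x Ux|i].
  by apply: differentiableV; [exact: df|exact: f0].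
have := CkN oU (CkM oU (pf i) (CkM oU CV CV)).
apply: eq_on_Ck => // x; rewrite inE => Ux.
by rewrite partialV//; [exact: df|exact: f0].
Qed.

Lemma smoothfD U f g : open U -> smoothf U f -> smoothf U g ->
  smoothf U (fun x => f x + g x).
Proof. by move=> oU sf sg k; apply: CkD. Qed.

Lemma smoothfB U f g : open U -> smoothf U f -> smoothf U g ->
  smoothf U (fun x => f x - g x).
Proof. by move=> oU sf sg k; apply: CkD => //; apply: CkN. Qed.

Lemma smoothfM U f g : open U -> smoothf U f -> smoothf U g ->
  smoothf U (fun x => f x * g x).
Proof. by move=> oU sf sg k; apply: CkM. Qed.

Lemma smoothf_sum U (I : Type) (r : seq I) (F : I -> E -> R) : open U ->
  (forall k, smoothf U (F k)) -> smoothf U (fun x => \sum_(k <- r) F k x).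
Proof.
move=> oU sF; elim: r => [|k r IH].
  by under eq_fun do rewrite big_nil; exact: smoothf_cst.
by under eq_fun do rewrite big_cons; exact: smoothfD.
Qed.

Lemma smoothf_prod U (I : Type) (r : seq I) (F : I -> E -> R) : open U ->
  (forall k, smoothf U (F k)) -> smoothf U (fun x => \prod_(k <- r) F k x).
Proof.
move=> oU sF; elim: r => [|k r IH].
  by under eq_fun do rewrite big_nil; exact: smoothf_cst.
by under eq_fun do rewrite big_cons; exact: smoothfM.
Qed.

Lemma smooth_on_entry U p q (F : E -> 'M[R]_(p, q)) a b : open U ->
  smooth_on U F -> smoothf U (fun x => F x a b).
Proof.
(* [F] is read as its iterated partial along the empty list, so that the induction on [k] can run
   over all lists of indices. *)
move=> oU sF k; rewrite -[F]/(foldr (@partial R n _) F [::]).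
elim: k [::] => [//|k IH] s; split=> [x Ux|i].
  by apply: differentiable_entry; exact: sF.
apply: eq_on_Ck (IH (i :: s)) => // x; rewrite inE => Ux.
by rewrite partial_entry//; exact: sF.
Qed.

Lemma partial_sym U f i j x : open U -> smoothf U f -> U x ->
  partial i (partial j f) x = partial j (partial i f) x.
Proof.
move=> oU sf Ux; apply: (derive_sym oU Ux).
- by move=> y; exact: smoothf_differentiable.
- exact/(smoothf_differentiable _ Ux)/smoothf_partial.
- exact/(smoothf_differentiable _ Ux)/smoothf_partial.
Qed.

End Smooth.

(** * Entrywise calculus of matrix-valued functions *)

Section MatrixFunctions.
Context (R : realType) (n : nat).
Local Notation E := 'rV[R]_n.
Implicit Types (x : E) (i j : 'I_n) (U : set E).

(** Differentiability, derivatives and smoothness of matrix functions are taken entry by entry, so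
    that each matrix rule reduces to the scalar one. *)
Definition mxdiff p q (F : E -> 'M[R]_(p, q)) x :=
  forall a b, differentiable (fun y => F y a b) x.

Definition pmx p q i (F : E -> 'M[R]_(p, q)) x : 'M[R]_(p, q) :=
  \matrix_(a, b) partial i (fun y => F y a b) x.

Definition smoothmx p q U (F : E -> 'M[R]_(p, q)) :=
  forall a b, smoothf U (fun x => F x a b).

Lemma smoothmx_diff p q U (F : E -> 'M[R]_(p, q)) x :
  smoothmx U F -> U x -> mxdiff F x.
Proof. by move=> sF Ux a b; exact: smoothf_differentiable (sF a b) Ux. Qed.

Lemma smoothmx_pmx p q U (F : E -> 'M[R]_(p, q)) i :
  smoothmx U F -> smoothmx U (pmx i F).
Proof.
by move=> sF a b; under eq_fun do rewrite mxE; exact/smoothf_partial/sF.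
Qed.

Lemma pmx_entry p q (F : E -> 'M[R]_(p, q)) i a b :
  (fun x => pmx i F x a b) = partial i (fun x => F x a b).
Proof. by apply/funext => x; rewrite mxE. Qed.

Lemma pmx_sym p q U (F : E -> 'M[R]_(p, q)) i j x : open U -> smoothmx U F ->
  U x -> pmx i (pmx j F) x = pmx j (pmx i F) x.
Proof.
move=> oU sF Ux; apply/matrixP => a b; rewrite [LHS]mxE [RHS]mxE !pmx_entry.
exact: partial_sym (sF a b) Ux.
Qed.

Lemma eq_on_pmx p q U (F G : E -> 'M[R]_(p, q)) i x : open U -> U x ->
  {in U, F =1 G} -> pmx i F x = pmx i G x.
Proof.
move=> oU Ux FG; apply/matrixP => a b; rewrite !mxE.
by apply: (eq_on_partial _ oU Ux) => y Uy; rewrite FG.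
Qed.

Lemma pmx_cst p q (A : 'M[R]_(p, q)) i x : pmx i (fun=> A) x = 0.
Proof. by apply/matrixP => a b; rewrite !mxE partial_cst. Qed.

Lemma mxdiffD p q (F G : E -> 'M[R]_(p, q)) x : mxdiff F x -> mxdiff G x ->
  mxdiff (fun y => F y + G y) x.
Proof.
by move=> dF dG a b; under eq_fun do rewrite mxE; exact: differentiableD.
Qed.

Lemma pmxD p q (F G : E -> 'M[R]_(p, q)) i x : mxdiff F x -> mxdiff G x ->
  pmx i (fun y => F y + G y) x = pmx i F x + pmx i G x.
Proof.
move=> dF dG; apply/matrixP => a b; rewrite !mxE.
by under eq_fun do rewrite mxE; rewrite partialD.
Qed.

Lemma mxdiffN p q (F : E -> 'M[R]_(p, q)) x : mxdiff F x ->
  mxdiff (fun y => - F y) x.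
Proof.
by move=> dF a b; under eq_fun do rewrite mxE; exact: differentiableN.
Qed.

Lemma pmxN p q (F : E -> 'M[R]_(p, q)) i x : mxdiff F x ->
  pmx i (fun y => - F y) x = - pmx i F x.
Proof.
move=> dF; apply/matrixP => a b; rewrite !mxE.
by under eq_fun do rewrite mxE; rewrite partialN.
Qed.

Lemma mxdiffM p q r (F : E -> 'M[R]_(p, q)) (G : E -> 'M[R]_(q, r)) x :
  mxdiff F x -> mxdiff G x -> mxdiff (fun y => F y *m G y) x.
Proof.
move=> dF dG a b; under eq_fun do rewrite mxE.
by apply: differentiable_bigsum => c; exact: differentiableM.
Qed.

Lemma pmxM p q r (F : E -> 'M[R]_(p, q)) (G : E -> 'M[R]_(q, r)) i x :
  mxdiff F x -> mxdiff G x ->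
  pmx i (fun y => F y *m G y) x = pmx i F x *m G x + F x *m pmx i G x.
Proof.
move=> dF dG; apply/matrixP => a b; rewrite !mxE.
under eq_fun do rewrite mxE.
rewrite partial_sum => [|c]; last exact: differentiableM.
by rewrite -big_split; apply: eq_bigr => c _; rewrite partialM// !mxE.
Qed.

Lemma mxdiffZ p q (f : E -> R) (F : E -> 'M[R]_(p, q)) x :
  differentiable f x -> mxdiff F x -> mxdiff (fun y => f y *: F y) x.
Proof.
move=> df dF a b; under eq_fun do rewrite mxE; exact: differentiableM.
Qed.

Lemma pmxZ p q (f : E -> R) (F : E -> 'M[R]_(p, q)) i x :
  differentiable f x -> mxdiff F x ->
  pmx i (fun y => f y *: F y) x = partial i f x *: F x + f x *: pmx i F x.
Proof.
move=> df dF; apply/matrixP => a b; rewrite !mxE.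
by under eq_fun do rewrite mxE; rewrite partialM.
Qed.

Lemma mxdiff_tr p q (F : E -> 'M[R]_(p, q)) x :
  mxdiff F x -> mxdiff (fun y => (F y)^T) x.
Proof. by move=> dF a b; under eq_fun do rewrite mxE; exact: dF. Qed.

Lemma pmx_tr p q (F : E -> 'M[R]_(p, q)) i x :
  pmx i (fun y => (F y)^T) x = (pmx i F x)^T.
Proof.
by apply/matrixP => a b; rewrite !mxE; under eq_fun do rewrite mxE.
Qed.

Lemma mxdiff_sum p q (I : Type) (r : seq I) (F : I -> E -> 'M[R]_(p, q)) x :
  (forall k, mxdiff (F k) x) -> mxdiff (fun y => \sum_(k <- r) F k y) x.
Proof.
move=> dF a b; under eq_fun do rewrite summxE.
by apply: differentiable_bigsum => k; exact: dF.
Qed.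

Lemma pmx_sum p q (I : Type) (r : seq I) (F : I -> E -> 'M[R]_(p, q)) i x :
  (forall k, mxdiff (F k) x) ->
  pmx i (fun y => \sum_(k <- r) F k y) x = \sum_(k <- r) pmx i (F k) x.
Proof.
move=> dF; apply/matrixP => a b; rewrite summxE mxE.
under eq_fun do rewrite summxE.
rewrite partial_sum => [|k]; last exact: dF.
by apply: eq_bigr => k _; rewrite mxE.
Qed.

Lemma pmx_comp p q (phi : E -> E) (F : E -> 'M[R]_(p, q)) i x :
  differentiable phi x -> mxdiff F (phi x) ->
  pmx i (F \o phi) x = \sum_b 'J phi x i b *: pmx b F (phi x).
Proof.
move=> dphi dF; apply/matrixP => a b; rewrite summxE mxE.
rewrite (partial_comp i dphi (dF a b)).
by apply: eq_bigr => c _; rewrite !mxE.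
Qed.

Lemma mxdiff_comp p q (phi : E -> E) (F : E -> 'M[R]_(p, q)) x :
  differentiable phi x -> mxdiff F (phi x) -> mxdiff (F \o phi) x.
Proof.
move=> dphi dF a b.
exact: (@differentiable_comp _ _ _ _ phi (fun y => F y a b)).
Qed.

Lemma smoothf_det U m (F : E -> 'M[R]_m) : open U -> smoothmx U F ->
  smoothf U (fun x => \det (F x)).
Proof.
move=> oU sF; apply: smoothf_sum => // s; apply: smoothfM => //.
  exact: smoothf_cst.
by apply: smoothf_prod => // k; exact: sF.
Qed.

(** Cramer's rule: on [U] the entries of the inverse are cofactors divided by a nonvanishing
    determinant, and both are polynomial in the entries of [F]. *)
Lemma smoothmx_inv U m (F : E -> 'M[R]_m) : open U -> smoothmx U F ->
  (forall x, U x -> F x \in unitmx) -> smoothmx U (fun x => invmx (F x)).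
Proof.
move=> oU sF uF a b.
have sC : smoothf U (fun x => (\det (F x))^-1 * cofactor (F x) b a).
  apply: smoothfM => //.
    move=> k; apply: CkV => //; last exact: smoothf_det.
    by move=> x /uF; rewrite unitmxE unitfE.
  apply: smoothfM => //; first exact: smoothf_cst.
  apply: smoothf_det => // c d; under eq_fun do rewrite !mxE; exact: sF.
apply: eq_on_smoothf sC => // x; rewrite inE => Ux.
by rewrite /invmx uF// !mxE.
Qed.

End MatrixFunctions.

Lemma smoothmx_sub (R : realType) (n p q : nat) (U V : set 'rV[R]_n)
    (F : 'rV[R]_n -> 'M[R]_(p, q)) :
  U `<=` V -> smoothmx V F -> smoothmx U F.
Proof.
move=> UV sF a b k; elim: k (fun x => F x a b) (sF a b k) => [//|k IH] f [df pf].
split=> [x Ux|i]; first exact: df (UV _ Ux).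
exact: IH (pf i).
Qed.

Section SmoothMatrices.
Context (R : realType) (n : nat) (U : set 'rV[R]_n).
Hypothesis oU : open U.

Lemma smoothmxD p q (F G : 'rV[R]_n -> 'M[R]_(p, q)) :
  smoothmx U F -> smoothmx U G -> smoothmx U (fun x => F x + G x).
Proof.
by move=> sF sG a b; under eq_fun do rewrite mxE; exact: smoothfD.
Qed.

Lemma smoothmxB p q (F G : 'rV[R]_n -> 'M[R]_(p, q)) :
  smoothmx U F -> smoothmx U G -> smoothmx U (fun x => F x - G x).
Proof.
by move=> sF sG a b; under eq_fun do rewrite !mxE; exact: smoothfB.
Qed.

Lemma smoothmxM p q r (F : 'rV[R]_n -> 'M[R]_(p, q)) (G : 'rV[R]_n -> 'M[R]_(q, r)) :
  smoothmx U F -> smoothmx U G -> smoothmx U (fun x => F x *m G x).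
Proof.
move=> sF sG a b; under eq_fun do rewrite mxE.
by apply: smoothf_sum => // c; exact: smoothfM.
Qed.

End SmoothMatrices.

(** * Levi-Civita connection and curvature *)

Section LocalGeometry.
Context (R : realType) (n : nat).
Local Notation E := 'rV[R]_n.
Implicit Types (x : E) (i j k l : 'I_n) (U : set E) (G T : E -> 'M[R]_n).

(* The connection matrices: row j holds the components of nabla_l (d_j). *)
Definition conn G l x : 'M[R]_n := \matrix_(j, k) christoffel G k l j x.

(** Row [j] holds the components of R(d_k, d_l) d_j. Because components are stored in rows,
    composing covariant derivatives multiplies the connection matrices in reverse order. *)
Definition curv G k l x : 'M[R]_n :=
  pmx k (conn G l) x - pmx l (conn G k) x
  + conn G l x *m conn G k x - conn G k x *m conn G l x.

Lemma conn_entry G l j k :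
  (fun x => conn G l x j k) = christoffel G k l j.
Proof. by apply/funext => x; rewrite mxE. Qed.

Lemma riemannE G l k i j x : riemann G l k i j x = curv G i j x k l.
Proof.
rewrite /riemann /curv /pmx !mxE !conn_entry -addrA; congr (_ + _).
rewrite big_split/= sumrN; congr (_ - _); apply: eq_bigr => m _;
  by rewrite !mxE mulrC.
Qed.

Lemma ricciE G x i j : ricci G x i j = \sum_l curv G l j x i l.
Proof. by rewrite mxE; apply: eq_bigr => l _; rewrite riemannE. Qed.

Lemma scalar_curvatureE G x :
  scalar_curvature G x = \tr (invmx (G x) *m (ricci G x)^T).
Proof.
by apply: eq_bigr => i _; rewrite mxE; apply: eq_bigr => j _; rewrite [in RHS]mxE.
Qed.

Lemma covariant_derivativeE G T i j l x : covariant_derivative G T i j l x =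
  (pmx l T x - conn G l x *m T x - T x *m (conn G l x)^T) i j.
Proof.
have subE (A B : 'M[R]_n) : (A - B) i j = A i j - B i j by rewrite !mxE.
rewrite !subE [pmx l T x i j]mxE; congr (_ - _ - _).
- by rewrite mxE; apply: eq_bigr => m _; rewrite mxE.
- by rewrite mxE; apply: eq_bigr => m _; rewrite !mxE mulrC.
Qed.

Section Metric.
Variables (U : set E) (G : E -> 'M[R]_n).
Hypotheses (oU : open U) (sG : smoothmx U G).
Hypothesis symG : forall x, U x -> (G x)^T = G x.
Hypothesis unitG : forall x, U x -> G x \in unitmx.

Lemma partial_metric_sym i a b x : U x ->
  partial i (fun y => G y a b) x = partial i (fun y => G y b a) x.
Proof.
move=> Ux; apply: (eq_on_partial _ oU Ux) => y; rewrite inE => Uy.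
by rewrite -[in LHS]symG// mxE.
Qed.

Lemma conn_sym i j k x : U x -> conn G i x j k = conn G j x i k.
Proof.
move=> Ux; rewrite !mxE /christoffel; congr (_ * _); apply: eq_bigr => l _.
rewrite (partial_metric_sym l i j Ux); congr (_ * (_ - _)); exact: addrC.
Qed.

(** Lowering the upper index cancels the inverse metric in [christoffel] and leaves the Christoffel
    symbols of the first kind. *)
Lemma conn_metric l i j x : U x -> (conn G l x *m G x) i j =
  2^-1 * (partial l (fun y => G y j i) x + partial i (fun y => G y j l) x
          - partial j (fun y => G y l i) x).
Proof.
move=> Ux; rewrite mxE.
under eq_bigr do rewrite mxE /christoffel -mulrA mulr_suml.
rewrite -mulr_sumr exchange_big/=; congr (_ * _).
transitivity (\sum_p (G x *m invmx (G x)) j p *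
   (partial l (fun y => G y p i) x + partial i (fun y => G y p l) x
          - partial p (fun y => G y l i) x)).
  apply: eq_bigr => p _; rewrite mxE mulr_suml; apply: eq_bigr => k _.
  have -> : G x k j = G x j k by rewrite -[in LHS]symG// mxE.
  by rewrite mulrC mulrA.
rewrite mulmxV ?unitG//.
rewrite (bigD1 j)//= mxE eqxx mul1r big1 ?addr0// => p pj.
by rewrite mxE eq_sym (negbTE pj) mul0r.
Qed.

(** Adding the lowered symbols for [i, j] and for [j, i] cancels all derivatives of the metric
    except the one along [l]. This is the statement that the metric is parallel. *)
Lemma metric_compat l x : U x ->
  pmx l G x = conn G l x *m G x + G x *m (conn G l x)^T.
Proof.
move=> Ux; apply/matrixP => i j.
have -> : G x *m (conn G l x)^T = (conn G l x *m G x)^T by rewrite trmx_mul symG.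
rewrite [RHS]mxE [_^T i j]mxE !conn_metric// [LHS]mxE.
rewrite (partial_metric_sym l j i Ux) (partial_metric_sym i j l Ux)
  (partial_metric_sym j i l Ux).
rewrite -mulrDr; move: (partial _ _ _) (partial _ _ _) (partial _ _ _) => a b c.
by field.
Qed.

(** Koszul's argument: for torsion-free, metric matrices [D], the combination of metric derivatives
    in [conn_metric] collapses to the lowered [D]. It serves to recognise the connection after a
    change of coordinates. *)
Lemma conn_unique (D : 'I_n -> 'M[R]_n) x : U x ->
  (forall i j k, D i j k = D j i k) ->
  (forall l, pmx l G x = D l *m G x + G x *m (D l)^T) ->
  forall l, D l = conn G l x.
Proof.
move=> Ux symD DG l; apply: (can_inj (mulmxK (unitG Ux))).
apply/matrixP => i j; rewrite conn_metric//.
have GD a b c : partial a (fun y => G y b c) x =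
    (D a *m G x) b c + (D a *m G x) c b.
  have := congr1 (fun M : 'M[R]_n => M b c) (DG a); rewrite [LHS]mxE => ->.
  rewrite [LHS]mxE; congr (_ + _).
  by rewrite -[G x in LHS]symG// -trmx_mul mxE.
have DS a b c : (D a *m G x) b c = (D b *m G x) a c.
  by rewrite !mxE; apply: eq_bigr => m _; rewrite symD.
rewrite !GD (DS i l j) (DS j l i) (DS j i l).
move: ((D l *m G x) i j) ((D l *m G x) j i) ((D i *m G x) j l) => a b c.
by field.
Qed.

Lemma smooth_conn l : smoothmx U (conn G l).
Proof.
move=> j k; rewrite conn_entry; apply: smoothfM => //; first exact: smoothf_cst.
apply: smoothf_sum => // p; apply: smoothfM => //; first exact: smoothmx_inv.
apply: smoothfB => //; first apply: smoothfD => //.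
all: exact/smoothf_partial/sG.
Qed.

Lemma smooth_curv k l : smoothmx U (curv G k l).
Proof.
apply: smoothmxB => //; last exact: smoothmxM (smooth_conn k) (smooth_conn l).
apply: smoothmxD => //; last exact: smoothmxM (smooth_conn l) (smooth_conn k).
by apply: smoothmxB => //; apply: smoothmx_pmx; exact: smooth_conn.
Qed.

Lemma smooth_ricci : smoothmx U (ricci G).
Proof.
move=> a b; under eq_fun do rewrite ricciE.
by apply: smoothf_sum => // l; exact: smooth_curv.
Qed.

End Metric.
End LocalGeometry.

(** * Pointwise algebra *)

Section MatrixAlgebra.
Context (R : realType) (n : nat).

Lemma addmxE p q (A B : 'M[R]_(p, q)) i j : (A + B) i j = A i j + B i j.
Proof. by rewrite mxE. Qed.

Lemma oppmxE p q (A : 'M[R]_(p, q)) i j : (- A) i j = - A i j.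
Proof. by rewrite mxE. Qed.

Lemma scalemxE p q a (A : 'M[R]_(p, q)) i j : (a *: A) i j = a * A i j.
Proof. by rewrite mxE. Qed.

Lemma zeromxE p q i j : (0 : 'M[R]_(p, q)) i j = 0.
Proof. by rewrite mxE. Qed.

Definition entryE := (addmxE, oppmxE, scalemxE, zeromxE).

(** The algebra behind the Ricci identity. [A] and [B] are the connection matrices along k and l,
    [a] and [b] the recurrence factors, [P], [Q], [c], [d] their cross derivatives, and [D A a] is
    the first derivative of [T] along k. The hypothesis equates the two mixed second derivatives of
    [T], and [F] is the curvature. *)
Lemma commutator_expansion (T A B P Q : 'M[R]_n) (a b c d : R) :
  let D X s := X *m T + T *m X^T + s *: T in
  P *m T + B *m D A a + (D A a *m B^T + T *m P^T) + (c *: T + b *: D A a) =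
  Q *m T + A *m D B b + (D B b *m A^T + T *m Q^T) + (d *: T + a *: D B b) ->
  let F := P - Q + B *m A - A *m B in
  F *m T + T *m F^T + (c - d) *: T = 0.
Proof.
move=> D e F; rewrite -[RHS](subrr (Q *m T + A *m D B b + (D B b *m A^T + T *m Q^T)
  + (d *: T + a *: D B b))).
rewrite -{1}e /F /D.
have trD (X Y : 'M[R]_n) : (X + Y)^T = X^T + Y^T by rewrite linearD.
have trN (X : 'M[R]_n) : (- X)^T = - X^T by rewrite linearN.
rewrite !(trD, trN) !trmx_mul.
rewrite !(mulmxDl, mulmxDr, mulmxBl, mulmxBr, mulNmx, mulmxN, mulmxA).
rewrite -!scalemxAl -!scalemxAr.
by apply/matrixP => i j; rewrite !entryE; ring.
Qed.

(** * The argument at one point: [F] is the curvature, [b] the recurrence form, [w] its exterior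
    derivative *)

Section PointwiseAlgebra.
Variables (G Ri : 'M[R]_n) (F : 'I_n -> 'I_n -> 'M[R]_n) (b : 'rV[R]_n).
Variable (w : 'I_n -> 'I_n -> R).
Hypotheses (n3 : (3 <= n)%N) (symG : G^T = G) (unitG : G \in unitmx).
Hypothesis posG : forall v : 'rV[R]_n, v != 0 -> 0 < (v *m G *m v^T) 0 0.
Hypothesis b0 : b != 0.
Hypothesis RiE : forall i j, Ri i j = \sum_l F l j i l.
Hypothesis FG : forall k l, F k l *m G + G *m (F k l)^T = 0.
Hypothesis FRi : forall k l, F k l *m Ri + Ri *m (F k l)^T + w k l *: Ri = 0.

Local Notation H := (invmx G).
(** The inner product that the inverse metric induces on covectors, which are stored as rows. *)
Let q (u v : 'rV[R]_n) := (u *m H *m v^T) 0 0.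

Let c := (\tr (H *m Ri)) / (2 * n%:R - 2).
Let S := Ri - c *: G.
Hypothesis cottonS : forall i j k, b 0 k * S i j = b 0 j * S i k.

Let symH : H^T = H. Proof. by rewrite trmx_inv symG. Qed.

Let q_gt0 (v : 'rV[R]_n) : v != 0 -> 0 < q v v.
Proof.
move=> v0; have : v *m H != 0.
  by apply: contraNneq v0 => /(congr1 (mulmx^~ G)); rewrite mulmxKV// mul0mx => ->.
by move=> /posG; rewrite mulmxKV// trmx_mul symH mulmxA.
Qed.

(** The skewness [FG] multiplied by [H] on both sides. *)
Let HF k l : H *m F k l = - ((F k l)^T *m H).
Proof.
apply/eqP; rewrite -addr_eq0; apply/eqP.
have /(congr1 (fun M => H *m M *m H)) := FG k l.
by rewrite mulmxDr mulmxDl !mulmxA mulVmx// mul1mx mulmxK// mulmx0 mul0mx.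
Qed.

(** By skewness this 1 by 1 matrix is the opposite of its own transpose. *)
Let qF k l (v : 'rV[R]_n) : v *m H *m F k l *m v^T = 0.
Proof.
have e : (v *m H *m F k l *m v^T)^T = - (v *m H *m F k l *m v^T).
  rewrite 3!trmx_mul trmxK symH -[v *m H *m _]mulmxA HF.
  by rewrite mulmxN mulNmx opprK !mulmxA.
apply/matrixP => i j; rewrite !ord1 zeromxE.
have := congr1 (fun M : 'M[R]_1 => M 0 0) e; rewrite /= [LHS]mxE oppmxE => e0.
by move: e0; move: (_ 0 0) => t; lra.
Qed.

(** [Ri] is a contraction of the matrices [F l j], and skewness rewrites [v *m H *m F l j] as minus
    the transpose of [F l j *m v^T] times [H]. *)
Let ricci_kernel (v : 'rV[R]_n) : (forall k l, F k l *m v^T = 0) -> v *m H *m Ri = 0.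
Proof.
move=> Fv; apply/matrixP => z j; rewrite !ord1 zeromxE mxE.
under eq_bigr do rewrite RiE mulr_sumr.
rewrite exchange_big/= big1// => l _.
have -> : \sum_i (v *m H) 0 i * F l j i l = (v *m H *m F l j) 0 l by rewrite mxE.
rewrite -mulmxA HF mulmxN mulmxA -[v *m _]trmxK trmx_mul trmxK Fv.
by rewrite trmx0 mul0mx oppr0 zeromxE.
Qed.

Let n_gt1 : 2 < n%:R :> R.
Proof. by rewrite ltr_nat. Qed.

Let trHS : \tr (H *m S) = (n%:R - 2) * c.
Proof.
rewrite /S mulmxBr -scalemxAr mulVmx// linearB/= linearZ/= mxtrace1.
have -> : \tr (H *m Ri) = (2 * n%:R - 2) * c.
  by rewrite mulrC divfK// subr_eq0; apply/eqP; have := n_gt1; lra.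
by ring.
Qed.

(** In the trace of [FRi] against [H] the two curvature terms cancel, by cyclicity and [HF]. *)
Let w_tr k l : w k l * \tr (H *m Ri) = 0.
Proof.
have /(congr1 (fun M => \tr (H *m M))) := FRi k l.
rewrite !mulmxDr mulmx0 mxtrace0 !linearD/= -scalemxAr linearZ/=.
rewrite [X in _ + X + _](_ : _ = - \tr (H *m (F k l *m Ri))) ?subrr ?add0r//.
by rewrite mulmxA mxtrace_mulC mulmxA -linearN/= [H *m (_ *m _)]mulmxA HF mulNmx opprK.
Qed.

Lemma recurrent_cotton_ricci0 : Ri = 0.
Proof.
have [k0 bk0] : exists k, b 0 k != 0.
  apply/existsP; rewrite -negb_forall; apply: contra b0 => /forallP b_eq0.
  by apply/eqP/rowP => k; rewrite (eqP (b_eq0 k)) mxE.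
(* By [cottonS] every column of [S] is proportional to column [k0]; dividing that column by [b 0 k0]
   gives the left factor of the rank-one form of [S]. *)
pose a : 'rV[R]_n := \row_i (S i k0 / b 0 k0).
have SE : S = a^T *m b.
  apply/matrixP => i j; rewrite [RHS]mxE big_ord1 [_^T i 0]mxE [a 0 i]mxE.
  rewrite mulrAC -[LHS](mulfK bk0).
  by rewrite -[S i j * _]mulrC cottonS [b 0 j * _]mulrC.
have trq : \tr (H *m S) = q b a.
  by rewrite SE mulmxA mxtrace_mulC mulmxA /mxtrace big_ord1.
(* [c] is a multiple of the trace in [w_tr]. Hence the term [c *: G] contributes nothing to [FRi],
   and [S] satisfies the same identity as [Ri]. *)
have wc k l : w k l * c = 0 by rewrite /c mulrA w_tr mul0r.
have RiS : Ri = S + c *: G by rewrite subrK.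
have FS k l : F k l *m S + S *m (F k l)^T + w k l *: S = 0.
  rewrite /S mulmxBr mulmxBl scalerBr scalerA wc scale0r subr0.
  rewrite -scalemxAl -scalemxAr -[RHS](FRi k l).
  have := FG k l; move=> /(congr1 (fun M => c *: M)); rewrite scaler0 scalerDr => FG0.
  by rewrite -[RHS]subr0 -[in RHS]FG0; apply/matrixP => i j; rewrite !entryE; ring.
have qb := q_gt0 b0.
have scal (u v : 'rV[R]_n) : u *m H *m v^T = (q u v)%:M by rewrite [LHS]mx11_scalar.
(* Contracting [FS] on the right with the vector dual to [b] kills the middle term by [qF]; what
   remains is divided by the positive number [q b b]. *)
have Fa k l : F k l *m a^T = - w k l *: a^T.
  have := FS k l; rewrite SE => /(congr1 (mulmx^~ (H *m b^T))).
  rewrite !mulmxDl mul0mx -scalemxAl.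
  have -> : F k l *m (a^T *m b) *m (H *m b^T) = q b b *: (F k l *m a^T).
    by rewrite !mulmxA -!mulmxA [b *m _]mulmxA scal mul_mx_scalar scalemxAr.
  have -> : a^T *m b *m (F k l)^T *m (H *m b^T) = 0.
    have e : b *m ((F k l)^T *m (H *m b^T)) = 0.
      rewrite [_^T *m _]mulmxA -[_^T *m H]opprK -HF mulNmx mulmxN !mulmxA.
      by rewrite qF oppr0.
    by rewrite -!mulmxA e mulmx0.
  have -> : a^T *m b *m (H *m b^T) = q b b *: a^T.
    by rewrite -!mulmxA [b *m _]mulmxA scal mul_mx_scalar.
  rewrite addr0 scalerA mulrC -scalerA -scalerDr => /eqP.
  by rewrite scaler_eq0 gt_eqF//= addr_eq0 => /eqP ->; rewrite scaleNr.
(* If [a = 0] then [S = 0], its trace [(n - 2) c] vanishes, and [n > 2] forces [c = 0]. The other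
   case will turn out contradictory. *)
have [a0|a0] := eqVneq a 0.
  have S0 : S = 0 by rewrite SE a0 trmx0 mul0mx.
  have := trHS; rewrite S0 mulmx0 mxtrace0 => /esym/eqP; rewrite mulf_eq0.
  rewrite subr_eq0 gt_eqF//= => /eqP c0.
  by rewrite RiS S0 c0 scale0r addr0.
have qa := q_gt0 a0.
(* Pairing [Fa] with [a] gives [- w k l * q a a] on one side and, by [qF], zero on the other. *)
have w0 k l : w k l = 0.
  have := qF k l a; rewrite -mulmxA Fa -scalemxAr scal.
  move=> /(congr1 (fun M : 'M[R]_1 => M 0 0)).
  rewrite scalemxE !mxE mulr1n => /eqP; rewrite mulf_eq0 (gt_eqF qa) orbF.
  by rewrite oppr_eq0 => /eqP.
have {}Fa k l : F k l *m a^T = 0 by rewrite Fa w0 oppr0 scale0r.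
(* With [w = 0] and [Fa], only the term in [b *m (F k l)^T] survives in [FS]; contracting on the
   left with the vector dual to [a] isolates it. *)
have Fb k l : F k l *m b^T = 0.
  have := FS k l; rewrite w0 scale0r addr0 SE mulmxA Fa mul0mx add0r.
  move=> /(congr1 (mulmx (a *m H))); rewrite !mulmxA scal mulmx0 mul_scalar_mx.
  rewrite -scalemxAl => /eqP; rewrite scaler_eq0 gt_eqF//= => /eqP e.
  by rewrite -[LHS]trmxK trmx_mul trmxK e trmx0.
have split (v : 'rV[R]_n) : v *m H *m Ri = q v a *: b + c *: v.
  by rewrite RiS mulmxDr -scalemxAr mulmxKV// SE mulmxA scal mul_scalar_mx.
(* At [v = b] the coefficient is [q b a + c], that is [(n - 2) c + c], so [c = 0]. At [v = a] what
   is left is [q a a *: b = 0], which is impossible. *)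
have := ricci_kernel Fb; rewrite split -scalerDl => /eqP.
rewrite scaler_eq0 (negbTE b0) orbF -trq trHS.
rewrite (_ : _ + c = (n%:R - 1) * c); last by ring.
rewrite mulf_eq0 subr_eq0 gt_eqF/=; last by have := n_gt1; lra.
move=> /eqP c0; have := ricci_kernel Fa; rewrite split c0 scale0r addr0 => /eqP.
by rewrite scaler_eq0 gt_eqF//= (negbTE b0).
Qed.

End PointwiseAlgebra.
End MatrixAlgebra.

(** * Recurrent tensors *)

Section Recurrence.
Context (R : realType) (n : nat).
Local Notation E := 'rV[R]_n.
Implicit Types (x : E) (i j k l : 'I_n) (U : set E) (G T : E -> 'M[R]_n).

(** The covariant equation solved for the partial derivatives. With [b = 0] it says that [T] is
    parallel, so that the metric is an instance as well. *)
Definition recurrent U G T (b : 'I_n -> E -> R) := forall x, U x -> forall l,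
  pmx l T x = conn G l x *m T x + T x *m (conn G l x)^T + b l x *: T x.

(** The recurrence equation is differentiated once more and substituted into itself; symmetry of the
    second partial derivatives of [T] then leaves only curvature and the exterior derivative of
    [b]. *)
Lemma ricci_identity U G T b k l x : open U -> U x ->
  (forall m, smoothmx U (conn G m)) -> smoothmx U T ->
  (forall m, smoothf U (b m)) -> recurrent U G T b ->
  curv G k l x *m T x + T x *m (curv G k l x)^T
    + (partial k (b l) x - partial l (b k) x) *: T x = 0.
Proof.
move=> oU Ux sC sT sb rec.
have dC m : mxdiff (conn G m) x by exact: smoothmx_diff (sC m) Ux.
have dT : mxdiff T x by exact: smoothmx_diff sT Ux.
have db m : differentiable (b m) x by exact: smoothf_differentiable (sb m) Ux.
have second i j : pmx i (pmx j T) x =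
    pmx i (conn G j) x *m T x + conn G j x *m pmx i T x
    + (pmx i T x *m (conn G j x)^T + T x *m (pmx i (conn G j) x)^T)
    + (partial i (b j) x *: T x + b j x *: pmx i T x).
  rewrite (@eq_on_pmx _ _ _ _ _ _ (fun y =>
    conn G j y *m T y + T y *m (conn G j y)^T + b j y *: T y) i x oU Ux).
    have dtr := mxdiff_tr (dC j).
    have dCT := mxdiffM (dC j) dT; have dTC := mxdiffM dT dtr.
    rewrite pmxD ?pmxD ?pmxM ?pmxZ ?pmx_tr//; first exact: mxdiffD.
    exact: mxdiffZ.
  by move=> y; rewrite inE => Uy; exact: rec.
apply: (commutator_expansion (a := b k x) (b := b l x)).
by have := pmx_sym k l oU sT Ux; rewrite (second k l) (second l k) !(rec x Ux).
Qed.

Lemma differentiable_tr m (F : E -> 'M[R]_m) x :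
  mxdiff F x -> differentiable (fun y => \tr (F y)) x.
Proof. by move=> dF; apply: differentiable_bigsum => k; exact: dF. Qed.

Lemma partial_tr m (F : E -> 'M[R]_m) i x :
  mxdiff F x -> partial i (fun y => \tr (F y)) x = \tr (pmx i F x).
Proof.
move=> dF; rewrite partial_sum => [|k]; last exact: dF.
by apply: eq_bigr => k _; rewrite mxE.
Qed.

Section Metric.
Variables (U : set E) (G : E -> 'M[R]_n).
Hypotheses (oU : open U) (sG : smoothmx U G).
Hypothesis symG : forall x, U x -> (G x)^T = G x.
Hypothesis unitG : forall x, U x -> G x \in unitmx.

Lemma metric_recurrent : recurrent U G G (fun _ _ => 0).
Proof. by move=> x Ux l; rewrite scale0r addr0; exact: (metric_compat oU symG unitG). Qed.

Lemma curv_metric k l x : U x ->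
  curv G k l x *m G x + G x *m (curv G k l x)^T = 0.
Proof.
move=> Ux; have s0 m : smoothf U ((fun (_ : 'I_n) (_ : E) => 0 : R) m).
  exact: smoothf_cst.
have := ricci_identity k l oU Ux (smooth_conn oU sG unitG) sG s0 metric_recurrent.
by rewrite !partial_cst subrr scale0r addr0.
Qed.

(** Transposing under the trace moves the transpose from Ricci to the inverse metric, which is
    symmetric. *)
Lemma scalar_curvature_tr x : U x ->
  scalar_curvature G x = \tr (invmx (G x) *m ricci G x).
Proof.
move=> Ux; rewrite scalar_curvatureE -mxtrace_tr trmx_mul trmxK.
by rewrite trmx_inv symG// mxtrace_mulC.
Qed.

(** Obtained by differentiating [invmx (G y) *m G y = 1] on [U]. *)
Lemma pmx_inv l x : U x ->
  pmx l (fun y => invmx (G y)) x = - (invmx (G x) *m pmx l G x *m invmx (G x)).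
Proof.
move=> Ux; have dG := smoothmx_diff sG Ux.
have dI := smoothmx_diff (smoothmx_inv oU sG unitG) Ux.
have : pmx l (fun y => invmx (G y) *m G y) x = 0.
  rewrite -(pmx_cst (1%:M : 'M[R]_n) l x); apply: (eq_on_pmx _ oU Ux) => y.
  by rewrite inE => Uy; rewrite mulVmx// unitG.
rewrite pmxM// => /eqP; rewrite addr_eq0 => /eqP/(congr1 (mulmx^~ (invmx (G x)))).
by rewrite mulmxK ?unitG// mulNmx.
Qed.

(** Because the metric is parallel, the connection terms coming from the inverse metric and from
    Ricci cancel under the trace, and only the recurrence factor remains. *)
Lemma partial_scalar_curvature b l x : U x -> recurrent U G (ricci G) b ->
  differentiable (scalar_curvature G) x /\
  partial l (scalar_curvature G) x = b l x * scalar_curvature G x.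
Proof.
move=> Ux rec; have dI := smoothmx_diff (smoothmx_inv oU sG unitG) Ux.
have dR := smoothmx_diff (smooth_ricci oU sG unitG) Ux.
have E y : y \in U -> \tr (invmx (G y) *m ricci G y) = scalar_curvature G y.
  by rewrite inE => Uy; rewrite scalar_curvature_tr.
split.
  by apply: (eq_on_differentiable oU Ux E); apply: differentiable_tr; exact: mxdiffM.
rewrite -(eq_on_partial l oU Ux E) partial_tr; last exact: mxdiffM.
rewrite pmxM// pmx_inv// (metric_compat oU symG unitG)// rec// scalar_curvature_tr//.
set H := invmx (G x); set C := conn G l x; set Ri := ricci G x.
have -> : H *m (C *m G x + G x *m C^T) *m H = H *m C + C^T *m H.
  by rewrite mulmxDr mulmxDl !mulmxA mulmxK ?unitG// mulVmx ?unitG// mul1mx.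
have cyc : \tr (H *m (Ri *m C^T)) = \tr (C^T *m H *m Ri).
  by rewrite mulmxA mxtrace_mulC mulmxA.
rewrite mulNmx mulmxDl !mulmxDr -scalemxAr linearD linearN !linearD linearZ/=.
by rewrite cyc mulmxA; move: (\tr _) (\tr _) (\tr _) => s t u; ring.
Qed.

Hypothesis posG : forall x, U x ->
  forall v : 'rV[R]_n, v != 0 -> 0 < (v *m G x *m v^T) 0 0.

(** Ricci and the scalar curvature both scale by [beta] and the metric is parallel, so the Schouten
    tensor is recurrent too ([covS]). The Cotton condition thereby becomes the algebraic symmetry
    required by the pointwise argument. *)
Lemma chart_recurrent_cotton (n3 : (3 <= n)%N) (beta : E -> E) x : U x ->
  smoothmx U beta -> recurrent U G (ricci G) (fun l y => beta y 0 l) ->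
  (forall i j k, cotton G i j k x = 0) -> beta x != 0 -> ricci G x = 0.
Proof.
move=> Ux sb rec cot b0; pose w k l := partial k (fun y => beta y 0 l) x
  - partial l (fun y => beta y 0 k) x.
have sR := smooth_ricci oU sG unitG; have dR := smoothmx_diff sR Ux.
have dG := smoothmx_diff sG Ux.
have covS i j k : covariant_derivative G (schouten G) i j k x
    = beta x 0 k * schouten G x i j.
  have [ds ps] := partial_scalar_curvature k Ux rec.
  rewrite covariant_derivativeE.
  have ds' : differentiable (fun y => scalar_curvature G y / (2 * n%:R - 2)) x.
    by apply: differentiableM => //; exact: differentiable_cst.
  have ps' : partial k (fun y => scalar_curvature G y / (2 * n%:R - 2)) x =
      beta x 0 k * (scalar_curvature G x / (2 * n%:R - 2)).
    rewrite partialM//.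
    by rewrite partial_cst mulr0 addr0 ps mulrA.
  rewrite /schouten pmxD ?pmxN ?pmxZ//; last 2 first.
  - exact: mxdiffZ.
  - exact/mxdiffN/mxdiffZ.
  rewrite ps' rec// (metric_compat oU symG unitG)// !mulmxBr !mulmxBl.
  rewrite -!scalemxAl -!scalemxAr.
  by rewrite !entryE; ring.
apply: (@recurrent_cotton_ricci0 _ _ (G x) _ (fun k l => curv G k l x) (beta x) w) => //.
- exact: symG.
- exact: unitG.
- exact: posG.
- by move=> i j; exact: ricciE.
- by move=> k l; exact: curv_metric.
- by move=> k l; apply: ricci_identity Ux _ _ _ rec => //; exact: smooth_conn.
- move=> i j k; rewrite -scalar_curvature_tr//; apply/eqP; rewrite -subr_eq0.
  by have := cot i j k; rewrite /cotton !covS => ->.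
Qed.

End Metric.
End Recurrence.

(** * Change of coordinates *)

Section ChangeOfCoordinates.
Context (R : realType) (n : nat).
Local Notation E := 'rV[R]_n.
Implicit Types (x : E) (i j k l : 'I_n).

(** The algebra behind [curv_transform]: [A *m J - J *m N] and [B *m J - J *m O] are the first
    derivatives of the Jacobian along k and l, and the hypothesis equates its mixed second
    derivatives. *)
Lemma integrability_expansion (J A B O N P Q dO dN : 'M[R]_n) :
  P *m J + B *m (A *m J - J *m N) - ((A *m J - J *m N) *m O + J *m dO) =
  Q *m J + A *m (B *m J - J *m O) - ((B *m J - J *m O) *m N + J *m dN) ->
  (P - Q + B *m A - A *m B) *m J = J *m (dO - dN + O *m N - N *m O).
Proof.
move=> e; apply/eqP; rewrite -subr_eq0; apply/eqP.
rewrite -[RHS](subrr (Q *m J + A *m (B *m J - J *m O)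
  - ((B *m J - J *m O) *m N + J *m dN))).
rewrite -{1}e !(mulmxDl, mulmxDr, mulmxBl, mulmxBr, mulNmx, mulmxN, mulmxA).
by apply/matrixP => i j; rewrite !entryE; ring.
Qed.

(** The product rule for [J *m A *m J^T], with [P] the derivative of [J], regrouped so that
    [P + J *m O] appears on both sides. *)
Lemma congruence_expansion (J P O A : 'M[R]_n) :
  (P *m A + J *m (O *m A + A *m O^T)) *m J^T + J *m A *m P^T =
  (P + J *m O) *m A *m J^T + J *m A *m (P + J *m O)^T.
Proof.
have trD (X Y : 'M[R]_n) : (X + Y)^T = X^T + Y^T by rewrite linearD.
rewrite trD trmx_mul !(mulmxDl, mulmxDr) !mulmxA.
by apply/matrixP => i j; rewrite !entryE; ring.
Qed.

Variables (U V : set E) (phi : E -> E) (G G' : E -> 'M[R]_n).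
Hypotheses (oU : open U) (oV : open V) (phiV : forall x, U x -> V (phi x)).
Hypothesis sphi : smooth_on U phi.
Hypotheses (sG : smoothmx U G) (sG' : smoothmx V G').
Hypothesis symG : forall x, U x -> (G x)^T = G x.
Hypothesis unitG : forall x, U x -> G x \in unitmx.
Hypothesis symG' : forall x, V x -> (G' x)^T = G' x.
Hypothesis unitG' : forall x, V x -> G' x \in unitmx.
Hypothesis GG' : forall x, U x -> G x = 'J phi x *m G' (phi x) *m ('J phi x)^T.

(** Equal to ['J phi] on [U]; this form shows the entries as partial derivatives, which gives
    smoothness and the symmetry [J_sym]. *)
Let J : E -> 'M[R]_n := fun x => \matrix_(i, k) partial i (fun y => phi y 0 k) x.

Let diff_phi x : U x -> differentiable phi x.
Proof. by move=> Ux; exact: (sphi [::] Ux). Qed.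

Let JE x : U x -> 'J phi x = J x.
Proof.
by move=> Ux; apply/matrixP => i k; rewrite jacobianE ?mxE//; exact: diff_phi.
Qed.

Let J_entry i k : (fun x => J x i k) = partial i (fun y => phi y 0 k).
Proof. by apply/funext => x; rewrite mxE. Qed.

Let sJ : smoothmx U J.
Proof.
by move=> i k; rewrite J_entry; apply/smoothf_partial; exact: smooth_on_entry.
Qed.

Let J_sym i j k x : U x -> pmx i J x j k = pmx j J x i k.
Proof.
move=> Ux; rewrite [LHS]mxE [RHS]mxE !J_entry; apply: partial_sym Ux => //.
exact: smooth_on_entry.
Qed.

(** The Jacobian is a left factor of the invertible matrix [G x]. *)
Let unitJ x : U x -> J x \in unitmx.
Proof.
move=> Ux; have := unitG Ux; rewrite GG'// JE// -mulmxA unitmx_mul.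
by case/andP.
Qed.

Let sC' i : smoothmx V (conn G' i).
Proof. exact: (smooth_conn oV sG' unitG'). Qed.

Let dC' i x : U x -> mxdiff (conn G' i) (phi x).
Proof. by move=> Ux; exact: smoothmx_diff (sC' i) (phiV Ux). Qed.

(* The connection matrices of G' pulled back by phi. *)
Let O i x : 'M[R]_n := \sum_b J x i b *: conn G' b (phi x).

Let dJ x : U x -> mxdiff J x. Proof. exact: smoothmx_diff. Qed.

Let pmx_G'phi l x : U x -> pmx l (G' \o phi) x =
  O l x *m G' (phi x) + G' (phi x) *m (O l x)^T.
Proof.
move=> Ux; rewrite pmx_comp; last 2 first.
- exact: diff_phi.
- exact: smoothmx_diff sG' (phiV Ux).
rewrite /O linear_sum mulmx_suml mulmx_sumr -big_split; apply: eq_bigr => b _ /=.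
rewrite JE// (metric_compat oV symG' unitG' _ (phiV Ux)) scalerDr linearZ/=.
by rewrite scalemxAl scalemxAr.
Qed.

(** The transformation law of the Christoffel symbols. The matrices [D] are torsion-free, by
    symmetry of the second derivatives of [phi] and of the lower indices of [conn G'], and they are
    metric for [G]; uniqueness of the Levi-Civita connection identifies them with [conn G]. *)
Let conn_J l x : U x -> pmx l J x = conn G l x *m J x - J x *m O l x.
Proof.
move=> Ux; pose D m := (pmx m J x + J x *m O m x) *m invmx (J x).
have DJ m : D m *m J x = pmx m J x + J x *m O m x by rewrite mulmxKV// unitJ.
have dG' : mxdiff (G' \o phi) x.
  apply: mxdiff_comp; first exact: diff_phi.
  exact: smoothmx_diff sG' (phiV Ux).
suff <- : D l = conn G l x by rewrite DJ addrK.
apply: (conn_unique symG unitG Ux) => [i j k|m].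
  rewrite [LHS]mxE [RHS]mxE; apply: eq_bigr => p _; congr (_ * _).
  rewrite [LHS]addmxE [RHS]addmxE; apply: (f_equal2 +%R (J_sym i j p Ux)).
  rewrite [LHS]mxE [RHS]mxE /O.
  under eq_bigr do rewrite summxE mulr_sumr.
  under [RHS]eq_bigr do rewrite summxE mulr_sumr.
  rewrite exchange_big/=; apply: eq_bigr => a _; apply: eq_bigr => b _.
  by rewrite !scalemxE (conn_sym oV symG' _ _ _ (phiV Ux)) mulrCA.
have -> : pmx m G x = pmx m (fun y => J y *m (G' \o phi) y *m (J y)^T) x.
  apply: (eq_on_pmx _ oU Ux) => y; rewrite inE => Uy; by rewrite GG'// JE.
rewrite !pmxM//; last 3 first.
- exact: dJ.
- by apply: mxdiffM => //; exact: dJ.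
- exact/mxdiff_tr/dJ.
rewrite pmx_tr pmx_G'phi//= GG'// JE// !mulmxA DJ -[_ *m (D m)^T]mulmxA -trmx_mul DJ.
exact: congruence_expansion.
Qed.

Let pmx_O k l x : U x -> pmx k (O l) x =
  \sum_b (pmx k J x l b *: conn G' b (phi x)
   + \sum_c (J x k c * J x l b) *: pmx c (conn G' b) (phi x)).
Proof.
move=> Ux; have dphi := diff_phi Ux.
have dC b : mxdiff (conn G' b \o phi) x by apply: mxdiff_comp => //; exact: dC'.
have dJE b : differentiable (fun y => J y l b) x by exact: dJ.
rewrite /O pmx_sum => [|b]; last exact: (mxdiffZ (dJE b) (dC b)).
apply: eq_bigr => b _; rewrite (pmxZ _ (dJE b) (dC b)) pmx_comp//; last exact: dC'.
rewrite [pmx k J x l b]mxE; congr (_ + _); rewrite scaler_sumr.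
by apply: eq_bigr => c _; rewrite JE// scalerA mulrC.
Qed.

Let mxdiff_O l x : U x -> mxdiff (O l) x.
Proof.
move=> Ux; apply: mxdiff_sum => b; apply: mxdiffZ; first exact: dJ.
by apply: mxdiff_comp; [exact: diff_phi|exact: dC'].
Qed.

(** The second derivatives of [phi] enter symmetrically in [k] and [l] and cancel; all other terms
    are bilinear in the Jacobian. *)
Let curv_O k l x : U x ->
  pmx k (O l) x - pmx l (O k) x + O l x *m O k x - O k x *m O l x =
  \sum_c \sum_b (J x k c * J x l b) *: curv G' c b (phi x).
Proof.
move=> Ux; rewrite !pmx_O// !big_split/=.
have -> : \sum_b pmx l J x k b *: conn G' b (phi x) =
          \sum_b pmx k J x l b *: conn G' b (phi x).
  by apply: eq_bigr => b _; apply: (f_equal2 *:%R _ erefl); exact: J_sym.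
have cancel (X Y Z : 'M[R]_n) : X + Y - (X + Z) = Y - Z.
  by rewrite opprD addrACA subrr add0r.
rewrite cancel.
have -> : O l x *m O k x = \sum_c \sum_b (J x k c * J x l b) *:
    (conn G' b (phi x) *m conn G' c (phi x)).
  rewrite mulmx_sumr; apply: eq_bigr => c _; rewrite mulmx_suml.
  by apply: eq_bigr => b _; rewrite -scalemxAl -scalemxAr scalerA mulrC.
have -> : O k x *m O l x = \sum_c \sum_b (J x k c * J x l b) *:
    (conn G' c (phi x) *m conn G' b (phi x)).
  rewrite mulmx_suml; apply: eq_bigr => c _; rewrite mulmx_sumr.
  by apply: eq_bigr => b _; rewrite -scalemxAl -scalemxAr scalerA.
rewrite exchange_big/= -sumrB -big_split -sumrB/=; apply: eq_bigr => c _.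
rewrite -sumrB -big_split -sumrB/=; apply: eq_bigr => b _.
by rewrite [J x l b * J x k c]mulrC -scalerBr -scalerDr -scalerBr.
Qed.

(** The integrability condition of [conn_J], obtained by commuting second derivatives of the
    Jacobian. *)
Lemma curv_transform k l x : U x ->
  curv G k l x *m J x =
  J x *m \sum_c \sum_b (J x k c * J x l b) *: curv G' c b (phi x).
Proof.
move=> Ux; have dC m : mxdiff (conn G m) x.
  exact: smoothmx_diff (smooth_conn oU sG unitG m) Ux.
have dJx := dJ Ux; have dO m := mxdiff_O m Ux.
have second i j : pmx i (pmx j J) x =
    pmx i (conn G j) x *m J x + conn G j x *m pmx i J x
    - (pmx i J x *m O j x + J x *m pmx i (O j) x).
  rewrite (@eq_on_pmx _ _ _ _ _ _ (fun y => conn G j y *m J y - J y *m O j y) i x oU Ux).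
    have dCJ := mxdiffM (dC j) dJx; have dJO := mxdiffM dJx (dO j).
    by rewrite pmxD ?pmxN ?pmxM//; exact: mxdiffN.
  by move=> y; rewrite inE => Uy; exact: conn_J.
have := pmx_sym k l oU sJ Ux; rewrite (second k l) (second l k) !(conn_J _ Ux).
by move=> /integrability_expansion; rewrite curv_O.
Qed.

Lemma ricci_transform x : U x ->
  ricci G x = J x *m ricci G' (phi x) *m (J x)^T.
Proof.
move=> Ux; apply/matrixP => i j.
have CE k l : curv G k l x =
    J x *m (\sum_c \sum_b (J x k c * J x l b) *: curv G' c b (phi x)) *m invmx (J x).
  by rewrite -curv_transform// mulmxK// unitJ.
(* The sum over the contracted index [l] cancels [invmx (J x)] against the factor [J x l c]. *)
transitivity (\sum_b J x j b * \sum_c (J x *m curv G' c b (phi x)) i c).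
  rewrite ricciE.
  transitivity (\sum_l \sum_c \sum_b J x j b *
      ((J x *m curv G' c b (phi x) *m invmx (J x)) i l * J x l c)).
    apply: eq_bigr => l _; rewrite CE mulmx_sumr mulmx_suml summxE.
    apply: eq_bigr => c _; rewrite mulmx_sumr mulmx_suml summxE.
    apply: eq_bigr => b _; rewrite -scalemxAr -scalemxAl scalemxE.
    by move: (curv G' c b (phi x)) => F; ring.
  rewrite exchange_big/=; under eq_bigr do rewrite exchange_big/=.
  rewrite exchange_big/=; apply: eq_bigr => b _; rewrite mulr_sumr.
  apply: eq_bigr => c _; rewrite -mulr_sumr; congr (_ * _).
  by rewrite -[in RHS](mulmxKV (unitJ Ux) (_ *m _)) [RHS]mxE.
rewrite [RHS]mxE; apply: eq_bigr => b _; rewrite [_^T b j]mxE mulrC; congr (_ * _).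
under eq_bigr do rewrite mxE.
rewrite exchange_big [RHS]mxE; apply: eq_bigr => p _.
by rewrite ricciE mulr_sumr.
Qed.

Lemma ricci_transform0 x : U x -> ricci G' (phi x) = 0 -> ricci G x = 0.
Proof. by move=> Ux r0; rewrite ricci_transform// r0 mulmx0 mul0mx. Qed.

End ChangeOfCoordinates.

(** * Linear systems of differential equations *)

(** The product of [h] with the integrating factor [expR (- C * s)] is nonincreasing on the unit
    interval. *)
Lemma gronwall_vanish (R : realType) (h dh : R -> R) (C : R) :
  (forall s : R, 0 <= s <= 1 -> is_derive s (1 : R) h (dh s)) ->
  (forall s : R, 0 <= s <= 1 -> dh s <= C * h s) -> h 0 <= 0 -> h 1 <= 0.
Proof.
move=> hD hC h0; pose g s := expR (- C * s) * h s.
have gD (s : R) : 0 <= s <= 1 ->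
    is_derive s (1 : R) g (expR (- C * s) * (dh s - C * h s)).
  move=> /hD Dh.
  have Dl : is_derive s (1 : R) (fun t : R => - C * t) (- C * 1).
    exact: (@is_deriveZ _ _ _ id (- C) s 1 1 (is_derive_id _ _)).
  have De : is_derive s (1 : R) (fun t => expR (- C * t)) (expR (- C * s) * (- C * 1)).
    exact: (@is_derive1_comp _ expR (fun t => - C * t) s _ _ (is_derive_expR _) Dl).
  have Dg := @is_deriveM _ _ (fun t => expR (- C * t)) h s 1 _ _ De Dh.
  apply: (@is_derive_eq _ _ _ g s 1 _ _ Dg).
  by rewrite /GRing.scale/=; ring.
have : g 1 <= g 0.
  apply: (@ler0_derive1_nincr _ g 0 1 _ _ _ 0 1 (lexx _) ler01 (lexx _)).
  - move=> s /[!in_itv]/= /andP[s0 s1]; have s01 : 0 <= s <= 1 by rewrite !ltW.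
    exact: (ex_derive (is_derive := gD _ s01)).
  - move=> s /[!in_itv]/= /andP[s0 s1]; have s01 : 0 <= s <= 1 by rewrite !ltW.
    rewrite derive1E (@derive_val _ _ _ _ _ _ _ (gD s s01)).
    by rewrite pmulr_rle0 ?expR_gt0// subr_le0 hC.
  - apply: derivable_within_continuous => s /[!in_itv]/= s01.
    exact: (ex_derive (is_derive := gD _ s01)).
rewrite /g mulr0 expR0 mul1r => /le_trans/(_ h0).
by rewrite pmulr_rle0// expR_gt0.
Qed.

Section LinearSystem.
Context (R : realType) (n : nat) (I : finType).
Local Notation E := 'rV[R]_n.

(** Along each short segment starting at [x], the sum [f] of the squares of the unknowns satisfies
    f' <= C f and starts at zero, so the Gronwall estimate makes it vanish. *)
Lemma linear_system_vanish (U : set E) (t : I -> E -> R)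
    (A : 'I_n -> I -> I -> E -> R) (x : E) :
  open U -> U x ->
  (forall a y, U y -> differentiable (t a) y) ->
  (forall l a c, differentiable (A l a c) x) ->
  (forall y, U y -> forall l a, partial l (t a) y = \sum_c A l a c y * t c y) ->
  (forall a, t a x = 0) -> \forall y \near x, forall a, t a y = 0.
Proof.
move=> oU Ux dt dA tE t0.
(* By continuity [K] still bounds every coefficient near [x]; the summand 1 makes the bound strict
   at [x]. *)
pose K : R := 1 + \sum_l \sum_a \sum_c `|A l a c x|.
have leK l a c : `|A l a c x| < K.
  have s3 (P : pred 'I_n) : 0 <= \sum_(l' | P l') \sum_a' \sum_c' `|A l' a' c' x|.
    by apply: sumr_ge0 => i _; apply: sumr_ge0 => j _; apply: sumr_ge0.
  have s2 (P : pred I) : 0 <= \sum_(a' | P a') \sum_c' `|A l a' c' x|.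
    by apply: sumr_ge0 => j _; apply: sumr_ge0.
  rewrite /K ltr_pwDl// (bigD1 l)//= (bigD1 a)//= (bigD1 c)//= -!addrA lerDl.
  by rewrite !addr_ge0// sumr_ge0.
have nA : \forall w \near (0 : E), forall p : 'I_n * I * I,
    `|A p.1.1 p.1.2 p.2 (x + w)| < K.
  apply: (@filter_forall _ _
    (fun p : 'I_n * I * I => [set w : E | `|A p.1.1 p.1.2 p.2 (x + w)| < K]) _
    (nbhs_filter (0 : E))).
  move=> -[[l a] c] /=.
  have cA : A l a c y @[y --> x] --> A l a c x.
    exact: differentiable_continuous.
  have : \forall y \near x, `|A l a c y| < K.
    exact: (cvgr_lt _ (cvg_norm cA)).
  by rewrite nbhs0P.
have nU : \forall w \near (0 : E), U (x + w).
  by have := open_nbhs_nbhs (conj oU Ux); rewrite -[nbhs x U]/(\near x, U x) nbhs0P.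
have [d /= d0 Hd] := nbhs_norm0P.1 (filterI nU nA).
apply/(nbhs0P (fun y => forall a, t a y = 0) x).
(* Radius [d] keeps the segment inside [U] and under the bound [K]; radius 1 bounds the coordinates
   of [v] by 1 in the sup norm. *)
apply/nbhs_norm0P; exists (Num.min d 1) => /=; first by rewrite lt_min d0 ltr01.
move=> v /=; rewrite lt_min => /andP[vd v1].
have K0 : 0 <= K.
  rewrite addr_ge0//; apply: sumr_ge0 => i _; apply: sumr_ge0 => j _.
  exact: sumr_ge0.
pose f y := \sum_a t a y * t a y.
have f_ge0 y : 0 <= f y by apply: sumr_ge0 => a _; rewrite -expr2 sqr_ge0.
have t_le_f a y : t a y * t a y <= f y.
  rewrite /f (bigD1 a)//= lerDl sumr_ge0// => c _; by rewrite -expr2 sqr_ge0.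
have ball s : 0 <= s <= 1 -> `|s *: v| < d.
  move=> /andP[s0 s1]; rewrite normrZ ger0_norm//; apply: le_lt_trans vd.
  by rewrite ler_piMl.
have df y : U y -> differentiable f y.
  by move=> Uy; apply: differentiable_bigsum => a; apply: differentiableM; exact: dt.
have pf y l : U y ->
    partial l f y = \sum_a \sum_c A l a c y * (t a y * t c y) *+ 2.
  move=> Uy; rewrite partial_sum => [|a]; last by apply: differentiableM; exact: dt.
  apply: eq_bigr => a _; rewrite partialM; try exact: dt.
  rewrite [_ * t a y]mulrC -mulr2n tE// mulr_sumr -sumrMnl; apply: eq_bigr => c _.
  by rewrite mulrCA.
(* Each triple contributes at most [K * 2 * f], since twice the absolute value of [t a * t c] is at
   most the sum of the two squares, each bounded by [f]. *)
pose C : R := \sum_(l < n) \sum_(a : I) \sum_(c : I) K * 2.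
have bound s : 0 <= s <= 1 -> 'D_v f (x + s *: v) <= C * f (x + s *: v).
  move=> s01; have [Uy /= Ay] := Hd _ (ball s s01).
  move: (x + s *: v) Uy Ay => y Uy Ay.
  rewrite (derive_partial _ (df y Uy)) /C mulr_suml; apply: ler_sum => l _.
  rewrite pf// mulr_sumr mulr_suml; apply: ler_sum => a _.
  rewrite mulr_sumr mulr_suml; apply: ler_sum => c _.
  apply: le_trans (ler_norm _) _; rewrite normrM -[leRHS]mul1r.
  apply: ler_pM => //.
    apply: le_trans (ltW v1); rewrite /Num.Def.normr/= mx_normrE.
    exact: (le_bigmax _ _ (0, l)).
  rewrite normrMn normrM -mulrnAr -mulrA; apply: ler_pM => //.
    by rewrite ltW// (Ay (l, a, c)).
  rewrite mulr_natl -mulr_natr; apply: (@le_trans _ _ (t a y * t a y + t c y * t c y)).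
    rewrite mulr_natr -normrMn ler_norml; apply/andP; split.
      have : 0 <= (t a y + t c y) ^+ 2 by exact: sqr_ge0.
      by rewrite mulr2n; lra.
    have : 0 <= (t a y - t c y) ^+ 2 by exact: sqr_ge0.
    by rewrite mulr2n; lra.
  by rewrite mulr2n lerD.
have : f (x + 1 *: v) <= 0.
  apply: (@gronwall_vanish _ (fun s => f (x + s *: v))
    (fun s => 'D_v f (x + s *: v)) C) => //.
    move=> s s01; apply: is_derive_line; apply: df.
    exact: (Hd _ (ball s s01)).1.
  by rewrite scale0r addr0 /f big1// => a _; rewrite t0 mul0r.
rewrite scale1r => f0 a.
have : t a (x + v) * t a (x + v) == 0.
  by rewrite eq_le (le_trans (t_le_f _ _) f0) -expr2 sqr_ge0.
by rewrite mulf_eq0 orbb => /eqP.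
Qed.

End LinearSystem.

(** The recurrence equation is a linear first-order system for the entries of [T], indexed by
    pairs. *)
Lemma recurrent_vanish (R : realType) (n : nat) (U : set 'rV[R]_n)
    (G T : 'rV[R]_n -> 'M[R]_n) (b : 'I_n -> 'rV[R]_n -> R) x :
  open U -> U x -> (forall m, smoothmx U (conn G m)) -> smoothmx U T ->
  (forall m, smoothf U (b m)) -> recurrent U G T b ->
  T x = 0 -> \forall y \near x, T y = 0.
Proof.
move=> oU Ux sC sT sb rec T0.
(* The three summands encode left multiplication by the connection matrix, right multiplication by
   its transpose, and scaling by [b]. *)
pose A l (p q : 'I_n * 'I_n) y : R :=
  conn G l y p.1 q.1 * (p.2 == q.2)%:R + (p.1 == q.1)%:R * conn G l y p.2 q.2
  + b l y * (p == q)%:R.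
have : \forall y \near x, forall p : 'I_n * 'I_n, T y p.1 p.2 = 0.
  apply: (@linear_system_vanish _ _ _ U (fun p y => T y p.1 p.2) A) => //.
  - by move=> p y Uy; exact: smoothf_differentiable (sT _ _) Uy.
  - move=> l p q; have dC i j : differentiable (fun y => conn G l y i j) x.
      exact: smoothf_differentiable (sC l i j) Ux.
    have dB : differentiable (b l) x by exact: smoothf_differentiable (sb l) Ux.
    apply: differentiableD; last by apply: differentiableM => //; exact: differentiable_cst.
    by apply: differentiableD; apply: differentiableM => //; exact: differentiable_cst.
  - move=> y Uy l [i j] /=.
    have := congr1 (fun M : 'M[R]_n => M i j) (rec y Uy l); rewrite [LHS]mxE => ->.
    rewrite !entryE /A/=.
    under [RHS]eq_bigr do rewrite !mulrDl.
    rewrite !big_split/=; congr (_ + _ + _).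
    + rewrite mxE -(pair_bigA _ (fun m p => conn G l y i m * (j == p)%:R * T y m p))/=.
      apply: eq_bigr => m _; rewrite (bigD1 j)//= eqxx mulr1 big1 ?addr0// => p pj.
      by rewrite eq_sym (negbTE pj) mulr0 mul0r.
    + rewrite mxE -(pair_bigA _ (fun m p => (i == m)%:R * conn G l y j p * T y m p))/=.
      rewrite [RHS](bigD1 i)//= [X in _ + X]big1 ?addr0 => [|m mi].
        by apply: eq_bigr => p _; rewrite eqxx mul1r mxE mulrC.
      by rewrite big1// => p _; rewrite eq_sym (negbTE mi) !mul0r.
    + rewrite (bigD1 (i, j))//= eqxx mulr1 big1 ?addr0// => p pij.
      by rewrite eq_sym (negbTE pij) mulr0 mul0r.
  - by move=> p; rewrite T0 mxE.
by apply: filterS => y Ty; apply/matrixP => i j; rewrite (Ty (i, j)) mxE.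
Qed.

(** * Zero set of the Ricci tensor *)

(** A nonzero row [v] in the kernel would give the quadratic form the value zero. *)
Lemma posdef_unitmx (R : realType) (n : nat) (G : 'M[R]_n) :
  (forall v : 'rV[R]_n, v != 0 -> 0 < (v *m G *m v^T) 0 0) -> G \in unitmx.
Proof.
move=> posG; rewrite -row_free_unit -kermx_eq0; apply: contraT => k0.
have := posG (nz_row (kermx G)); rewrite nz_row_eq0 => /(_ k0).
by have /sub_kermxP -> := nz_row_sub (kermx G); rewrite mul0mx mxE ltxx.
Qed.

Section Charts.
Context (R : realType) (n : nat) (M : topologicalType).
Implicit Types (c d : chart R n M) (p : M).

Lemma chart_near c p (P : 'rV[R]_n -> Prop) : chart_dom c p ->
  (\forall y \near chart_map c p, P y) ->
  \forall q \near p, chart_dom c q /\ P (chart_map c q).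
Proof.
move=> cp nP; have oc := chart_dom_open c.
have nc : \forall q \near p, chart_dom c q by apply: open_nbhs_nbhs.
have cc : {for p, continuous (chart_map c)}.
  have := @chart_map_continuous _ _ _ c.
  by rewrite continuous_open_subspace// => /(_ p); apply; rewrite inE.
by near=> q; split; [near: q|near: q; exact: cc].
Unshelve. all: by end_near. Qed.

Lemma overlapP c d x : overlap c d x <->
  chart_img c x /\ chart_dom d (chart_inv c x).
Proof.
split=> [[p [cp dp] <-]|[[p cp <-]]].
  by split; [exists p|rewrite chart_mapK].
by rewrite chart_mapK// => dp; exists p.
Qed.

(** The overlap is the part of the open set [chart_img c] that the continuous [chart_inv c] sends
    into [chart_dom d]. *)
Lemma overlap_open c d : open (overlap c d).
Proof.
rewrite openE => x /overlapP[cx dx].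
have cc : {for x, continuous (chart_inv c)}.
  have := @chart_inv_continuous _ _ _ c.
  rewrite continuous_open_subspace//; last exact: chart_img_open.
  by move=> /(_ x); apply; rewrite inE.
have nd : \forall y \near x, chart_dom d (chart_inv c y).
  by apply: cc; apply: open_nbhs_nbhs; split => //; exact: chart_dom_open.
have nc : \forall y \near x, chart_img c y.
  by apply: open_nbhs_nbhs; split => //; exact: chart_img_open.
by near=> y; apply/overlapP; split; near: y.
Unshelve. all: by end_near. Qed.

End Charts.

Section RicciVanishing.
Context (R : realType) (n : nat) (M : smooth_manifold R n).
Variable g : riemannian_metric M.
Implicit Types (c d : chart R n M) (p : M).

Lemma metric_smoothmx c : atlas c -> smoothmx (chart_img c) (g c).
Proof.
move=> ac i j; apply: smooth_on_entry; first exact: chart_img_open.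
exact: metric_smooth.
Qed.

Lemma metric_unit c : atlas c -> forall x, chart_img c x -> g c x \in unitmx.
Proof. by move=> ac x cx; apply: posdef_unitmx; exact: (metric_posdef g). Qed.

Lemma ricci_smoothmx c : atlas c -> smoothmx (chart_img c) (ricci (g c)).
Proof.
move=> ac; apply: smooth_ricci; first exact: chart_img_open.
- exact: metric_smoothmx.
- exact: metric_unit.
Qed.

Lemma ricci_eq0_chart c d p : atlas c -> atlas d -> chart_dom c p ->
  chart_dom d p -> ricci (g d) (chart_map d p) = 0 ->
  ricci (g c) (chart_map c p) = 0.
Proof.
move=> ac ad cp dp r0.
have sub x : overlap c d x -> chart_img c x by move=> /overlapP[].
apply: (@ricci_transform0 _ _ (overlap c d) (chart_img d) (transition c d)
  (g c) (g d)) => //.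
- exact: overlap_open.
- exact: chart_img_open.
- by move=> x [q [cq dq] <-]; exists q => //; rewrite /transition/= chart_mapK.
- exact: atlas_smooth.
- exact: smoothmx_sub sub (metric_smoothmx ac).
- exact: metric_smoothmx.
- by move=> x /sub cx; exact: (Defs.metric_sym g).
- by move=> x /sub cx; exact: metric_unit.
- by move=> x dx; exact: (Defs.metric_sym g).
- exact: metric_unit.
- by move=> x ox; exact: (metric_transform g).
- by exists p.
- by rewrite /transition/= chart_mapK.
Qed.

(** Asking for one chart is the same as asking for all of them by [ricci_eq0_chart], which is why
    this set and [ricci_support] are complementary. *)
Definition ricci_zero_set : set M :=
  [set p | exists c, [/\ atlas c, chart_dom c p & ricci (g c) (chart_map c p) = 0]].

Definition ricci_support : set M :=
  [set p | exists c, [/\ atlas c, chart_dom c p & ricci (g c) (chart_map c p) <> 0]].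

Lemma ricci_supportC : ~` ricci_zero_set = ricci_support.
Proof.
apply/seteqP; split=> p.
  move=> zp; have [c ac cp] := atlas_cover p; exists c; split=> // r0.
  by apply: zp; exists c.
move=> [c [ac cp rc]] [d [ad dp rd]]; apply: rc; exact: ricci_eq0_chart rd.
Qed.

Lemma ricci_support_open : open ricci_support.
Proof.
rewrite openE => p [c [ac cp rc]].
have [[i j] rij] : exists ij : 'I_n * 'I_n, ricci (g c) (chart_map c p) ij.1 ij.2 != 0.
  apply/existsP; rewrite -negb_forall; apply/negP => /forallP r0; apply: rc.
  by apply/matrixP => i j; rewrite (eqP (r0 (i, j))) mxE.
have cx : chart_img c (chart_map c p) by exists p.
have /differentiable_continuous cr :=
  smoothf_differentiable (ricci_smoothmx ac i j) cx.
have nr : \forall y \near chart_map c p, ricci (g c) y i j != 0.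
  exact: cvgr_neq0 cr rij.
apply: filterS (chart_near cp nr) => q [cq rq]; exists c; split=> // r0.
by rewrite r0 mxE eqxx in rq.
Qed.

Lemma recurrence_matrix c (beta : one_form M) : atlas c ->
  (forall x, chart_img c x -> forall i j l,
      covariant_derivative (g c) (ricci (g c)) i j l x =
        beta c x 0 l * ricci (g c) x i j) ->
  recurrent (chart_img c) (g c) (ricci (g c)) (fun l y => beta c y 0 l).
Proof.
move=> ac rec x cx l; apply/matrixP => i j.
have := rec x cx i j l; rewrite covariant_derivativeE !entryE => <-; ring.
Qed.

Lemma one_form_smoothmx c (beta : one_form M) : atlas c ->
  smoothmx (chart_img c) (beta c).
Proof.
move=> ac i j; apply: smooth_on_entry; first exact: chart_img_open.
exact: one_form_smooth.
Qed.

(** Uniqueness for the recurrence system gives vanishing near the point in a chart, and [chart_near]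
    carries this to the manifold. *)
Lemma ricci_zero_set_open (beta : one_form M) :
  (forall c, atlas c -> forall x, chart_img c x -> forall i j l,
      covariant_derivative (g c) (ricci (g c)) i j l x =
        beta c x 0 l * ricci (g c) x i j) ->
  open ricci_zero_set.
Proof.
move=> rec; rewrite openE => p [c [ac cp rc]].
have cx : chart_img c (chart_map c p) by exists p.
have oc : open (chart_img c) by exact: chart_img_open.
have sC m : smoothmx (chart_img c) (conn (g c) m).
  exact: smooth_conn oc (metric_smoothmx ac) (metric_unit ac) m.
have sb m : smoothf (chart_img c) (fun y => beta c y 0 m).
  exact: one_form_smoothmx.
have nr := recurrent_vanish oc cx sC (ricci_smoothmx ac) sb
  (recurrence_matrix ac (rec c ac)) rc.
by apply: filterS (chart_near cp nr) => q [cq rq]; exists c.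
Qed.

End RicciVanishing.

(** * Spreading the vanishing of Ricci over a connected component *)

Theorem corollary3p1 (R : realType) (n : nat) (hn : (3 <= n)%N)
    (M : smooth_manifold R n) (g : riemannian_metric M)
    (hRi : ricci_nonzero g) :
  ~ (ricci_recurrent g /\ ricci_cotton g).
Proof.
move=> [[beta beta0 rec] cot].
have [c0 [ac0 [_ [p c0p <-] /eqP rp]]] := hRi.
(* [B] is a connected set that joins [p], where Ricci is nonzero, to a point [q] where the
   recurrence form is nonzero. *)
have [q [c [[B [Bp _ cB] Bq] ac cq bq]]] := beta0 p.
have cx : chart_img c (chart_map c q) by exists q.
have zq : ricci_zero_set g q.
  exists c; split=> //; have oc : open (chart_img c) by exact: chart_img_open.
  have symg x : chart_img c x -> (g c x)^T = g c x by exact: (Defs.metric_sym g).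
  have posg x : chart_img c x -> forall v : 'rV[R]_n, v != 0 ->
    0 < (v *m g c x *m v^T) 0 0 by exact: (metric_posdef g).
  exact: (chart_recurrent_cotton oc (metric_smoothmx g ac) symg
    (metric_unit g ac) posg hn cx (one_form_smoothmx beta ac)
    (recurrence_matrix ac (rec c ac)) (cot c ac _ cx) bq).
have sp : ricci_support g p by exists c0.
(* The support meets [B] at [p] and is open and closed, so connectedness would put all of [B] inside
   it, against the vanishing of Ricci at [q]. *)
suff /seteqP[_ /(_ q Bq)[_]] : B `&` ricci_support g = B.
  by rewrite -ricci_supportC.
apply: cB; first by exists p.
  by exists (ricci_support g) => //; exact: ricci_support_open.
exists (~` ricci_zero_set g); last by rewrite ricci_supportC.
exact/open_closedC/(ricci_zero_set_open rec).
Qed.
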